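(* Fix an integer $r\geq 1$, let $\mathbf v=(v_1,\dots,v_r)$, and let $a_1(\mathbf v),\dots,a_{r+1}(\mathbf v)$ be the polynomials in $\mathbf v$ uniquely determined by the identity in the variable $x$ $$\sum_{k=1}^{r+1} k\,a_k(\mathbf v)\prod_{j=0}^{k-2}(x-j)=\prod_{i=1}^r(x+v_i).$$ Then, with $t_n=p_n/n$, $$Z_{(r)}(s;v_1,\dots,v_r;\mathbf p)=\exp\Big(s\sum_{k=1}^{r+1}a_k(\mathbf v)P^{(k)}_{-1}\Big)(1).$$
   Context: For $d\geq 0$, a partition $\mu$ of $d$ and integers $k_1,\dots,k_r$, let $N^\bullet_{k_1,\dots,k_r}(\mu)=\frac{1}{d!}\#\{(\alpha_1,\dots,\alpha_r,\alpha)\in (S_d)^{r+1}:\alpha_1\cdots\alpha_r\alpha=e,\ \alpha_i \text{ has exactly } k_i \text{ cycles},\ \alpha \text{ has cycle type }\mu\}$ (the weighted count of possibly disconnected branched covers of $\mathbb{CP}^1$ over $r+1$ points with $k_i$ preimages over the $i$-th point and profile $\mu$ over the last). The generalized dessin partition function is $Z_{(r)}(s;\mathbf v;\mathbf p)=\sum_{k_1,\dots,k_r\ge 0}\sum_{\mu\in\mathcal P}\big(\prod_i v_i^{k_i}\big)s^{|\mu|}N^\bullet_{k_1,\dots,k_r}(\mu)p_\mu$ over all partitions $\mu$ (the empty partition contributes the constant term $1$), with $p_\mu=p_{\mu_1}\cdots p_{\mu_l}$. The operators $P^{(k)}_{-1}$ act on formal power series in $\mathbf t=(t_1,t_2,\dots)$: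 let $J(z)=\sum_{n\geq1}nt_nz^{n-1}+\sum_{n\geq1}\frac{\partial}{\partial t_n}z^{-n-1}$, let $P^{(k)}(z)={:}\big(\partial_z+J(z)\big)^{k-1}J(z){:}$, where $\partial_z$ differentiates everything to its right (including the $z$-dependence of $J(z)$) and the normal ordering ${:}\ {:}$ places all operators $\partial/\partial t_n$ to the right of all multiplication operators $t_m$; write $P^{(k)}(z)=\sum_{m\in\mathbb Z}P^{(k)}_m z^{-m-k}$. For example $P^{(1)}_{-1}=t_1$ and $P^{(2)}_{-1}=\sum_{n\ge1}2(n+1)t_{n+1}\frac{\partial}{\partial t_n}$. The exponential is a formal power series in $s$ applied to the constant function $1$. *)

(* Defs.v *)
From HB Require Import structures.
From mathcomp Require Import all_boot all_order all_algebra all_fingroup.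
From mathcomp Require Import finmap multiset.
From mathcomp Require Import boolp classical_sets cardinality fsbigop.
From mathcomp Require Import mpoly.

Set Implicit Arguments.
Unset Strict Implicit.
Unset Printing Implicit Defensive.

Import GRing.Theory Num.Theory.
Local Open Scope ring_scope.

Definition posnat := {n : nat | (0 < n)%N}.

(* A partition, given as the multiset of its (positive) parts.  The same type
   serves for the monomials in p_1, p_2, ... (mu stands for p_mu) and for the
   monomials in t_1, t_2, ... (mu stands for the product of t_n, n in mu). *)
Definition ipartition := {mset posnat}%mset.

Definition weight (mu : ipartition) : nat := (\sum_(n <- enum_mset mu) val n)%N.

(* Formal power series in infinitely many variables (p_n or t_n), and formal
   power series in s whose coefficients are such series: [Z d mu] is the
   coefficient of s^d times the monomial mu. *)
Definition series (A : Type) := ipartition -> A.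
Definition sseries (A : Type) := nat -> series A.

Definition ncycles (d : nat) (al : 'S_d) : nat := #|porbits al|.

Definition has_cycle_type (d : nat) (al : 'S_d) (mu : ipartition) : bool :=
  perm_eq [seq #|X| | X : {set 'I_d} <- enum (porbits al)]
          [seq val n | n <- enum_mset mu].

Definition cover_tuples (r : nat) (k : 'I_r -> nat) (mu : ipartition) :=
  [set x : {ffun 'I_r -> 'S_(weight mu)} * 'S_(weight mu)
         | [&& ((\prod_(i < r) x.1 i) * x.2 == 1)%g,
               [forall i, ncycles (x.1 i) == k i]
             & has_cycle_type x.2 mu]]%SET.

Definition Nbullet (r : nat) (k : 'I_r -> nat) (mu : ipartition) : rat :=
  #|cover_tuples k mu|%:R / (weight mu)`!%:R.

(* The coefficients are polynomials in v_1, ..., v_r, with v_i = 'X_i.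
   The family summed over (k_1, ..., k_r) in nat^r has finite support, see
   [Zdessin_support] below. *)
Definition Zdessin (r : nat) : sseries {mpoly rat[r]} := fun d mu =>
  if d == weight mu then
    \sum_(k \in [set: {ffun 'I_r -> nat}])
      Nbullet k mu *: \prod_(i < r) 'X_i ^+ k i
  else 0.

(* The substitution p_n = n t_n, i.e. t_n = p_n / n. *)
Definition p_to_t (A : lmodType rat) (Z : sseries A) : sseries A :=
  fun d mu => (\prod_(n <- enum_mset mu) (val n)%:R) *: Z d mu.

(* Normal ordering depends on how an operator is written and not only on the
   operator, so the currents are expanded in words in the letters t_n (inl n)
   and d/dt_n (inr n). A field is a formal sum of words and powers of z:
   [F m w] is the coefficient of z^m w. *)
Definition letter : Type := (posnat + posnat)%type.
Definition word := seq letter.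
Definition zfield := int -> word -> rat.

Definition Jfield : zfield := fun m w =>
  match w with
  | [:: inl n] => if m == (val n)%:Z - 1 then (val n)%:R else 0
  | [:: inr n] => if m == - (val n)%:Z - 1 then 1 else 0
  | _ => 0
  end.

Definition addF (F G : zfield) : zfield := fun m w => F m w + G m w.

(* Noncommutative product: the word w is cut in two in all possible ways. When
   F is J the inner sum has finite support, see [mulF_Jfield_support]. *)
Definition mulF (F G : zfield) : zfield := fun m w =>
  \sum_(i < (size w).+1)
    \sum_(x \in [set: int]) F x (take i w) * G (m - x) (drop i w).

Definition derivF (F : zfield) : zfield := fun m w => (m + 1)%:~R * F (m + 1) w.

(* (d/dz + J)^(k-1) J, before normal ordering *)
Definition Pfield (k : nat) : zfield :=
  iter k.-1 (fun F => addF (derivF F) (mulF Jfield F)) Jfield.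

Definition is_t (l : letter) : bool := if l is inl _ then true else false.

Definition normal_order (w : word) : word :=
  filter is_t w ++ filter (predC is_t) w.

Section Operators.

Variable A : lmodType rat.
Implicit Types f : series A.

Definition mul_t (n : posnat) f : series A :=
  fun mu => if n \in mu then f (mu `\ n)%mset else 0.

Definition diff_t (n : posnat) f : series A :=
  fun mu => f (n +` mu)%mset *+ (mu n).+1.

Definition act_letter (l : letter) f : series A :=
  match l with inl n => mul_t n f | inr n => diff_t n f end.

(* The rightmost letter acts first. *)
Definition act_word (w : word) f : series A := foldr act_letter f w.

(* P^(k)_m, the coefficient of z^(-m-k) of :(d/dz + J)^(k-1) J:. Only finitely
   many words contribute to a given coefficient, see [Pop_support] below. *)
Definition Pop (k : nat) (m : int) f : series A := fun mu =>
  \sum_(w \in [set: word])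
    Pfield k (- m - k%:Z) w *: act_word (normal_order w) f mu.

(* exp(s D) f; the power d of s carries D^d f / d! *)
Definition exp_s (D : series A -> series A) f : sseries A :=
  fun d mu => (d`!%:R)^-1 *: iter d D f mu.

End Operators.

Definition series1 (A : pzRingType) : series A :=
  fun mu => if mu == mset0 then 1 else 0.

(* a i is a_k with k = i + 1. *)
Definition a_identity (r : nat) (a : {ffun 'I_r.+1 -> {mpoly rat[r]}}) : Prop :=
  \sum_(i < r.+1)
     (i.+1%:R * a i)%:P * \prod_(j < i) ('X - (j%:R)%:P)
  = \prod_(i < r) ('X + ('X_i)%:P) :> {poly {mpoly rat[r]}}.

Definition dessin_op (r : nat) (a : {ffun 'I_r.+1 -> {mpoly rat[r]}})
    (f : series {mpoly rat[r]}) : series {mpoly rat[r]} :=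
  fun mu => \sum_(i < r.+1) a i * Pop i.+1 (- 1) f mu.

(* Finiteness of the supports of the infinite sums used above. *)

Lemma Zdessin_support (r : nat) (mu : ipartition) :
  finite_set [set k : {ffun 'I_r -> nat} | Nbullet k mu != 0]%classic.
Proof.
set d := weight mu.
pose h (g : {ffun 'I_r -> 'I_d.+1}) := [ffun i => g i : nat].
apply: (@sub_finite_set _ _ (h @` [set: _])%classic); last first.
  by apply: finite_image; exact: finite_finset.
move=> k /=; rewrite /Nbullet; case: (set_0Vmem (cover_tuples k mu)) => [->|].
  by rewrite cards0 mul0r eqxx.
case=> x; rewrite inE => /and3P[_ /forallP kx _] _.
exists [ffun i => inord (k i)] => //; apply/ffunP => i; rewrite !ffunE inordK//.
rewrite ltnS -(eqP (kx i)) /ncycles /porbits.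
by apply: leq_trans (leq_imset_card _ _) _; rewrite card_ord.
Qed.

(* The letter l occurs in J multiplied by z^(deg l - 1). *)
Definition ldeg (l : letter) : int :=
  match l with inl n => (val n)%:Z | inr n => - (val n)%:Z end.

Lemma Jfield_deg (x : int) (w : word) :
  Jfield x w != 0 -> exists2 l, w = [:: l] & x = ldeg l - 1.
Proof.
case: w => [|[n|n] [|? ?]] //=; rewrite ?eqxx //;
  case: (x =P _) => [-> _|_]; rewrite ?eqxx //.
- by exists (inl n).
- by exists (inr n).
Qed.

Lemma mulF_Jfield_support (F : zfield) (m : int) (w1 w2 : word) :
  finite_set [set x | Jfield x w1 * F (m - x) w2 != 0]%classic.
Proof.
apply: (@sub_finite_set _ _ [set ldeg (head (inl (exist _ 1%N isT)) w1) - 1]%classic).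
  move=> x /=; rewrite mulf_eq0 negb_or => /andP[/Jfield_deg[l -> ->] _].
  by [].
exact: finite_set1.
Qed.

Lemma Pfield_deg (k : nat) (x : int) (w : word) : (0 < k)%N ->
  Pfield k x w != 0 ->
  (size w <= k)%N /\ \sum_(l <- w) ldeg l = x + k%:Z.
Proof.
case: k => // k _; rewrite /Pfield /=; elim: k x w => [|k IHk] x w /=.
  by case/Jfield_deg=> l -> ->; rewrite big_seq1 subrK.
set F := iter k _ _ in IHk *; rewrite /addF => nz.
have [dnz|] := boolP (derivF F x w != 0).
  have /IHk[sw ->] : F (x + 1) w != 0.
    by apply: contraNneq dnz => F0; rewrite /derivF F0 mulr0.
  by split; [exact: leqW | rewrite -addrA -PoszD add1n].
rewrite negbK => /eqP d0; move: nz; rewrite d0 add0r /mulF.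
rewrite (bigID (fun i : 'I_(size w).+1 => \sum_(x0 \in [set: int]%classic)
   Jfield x0 (take i w) * F (x - x0) (drop i w) == 0)) /= big1 ?add0r; last first.
  by move=> i /eqP.
case: (pickP (fun i : 'I_(size w).+1 => \sum_(x0 \in [set: int]%classic)
   Jfield x0 (take i w) * F (x - x0) (drop i w) != 0)) => [i nz _|n0]; last first.
  by rewrite big_pred0 ?eqxx// => i; rewrite n0.
have [y _] : exists2 y, [set: int]%classic y &
    Jfield y (take i w) * F (x - y) (drop i w) != 0.
  apply: contrapT => ne; move: nz; rewrite fsbig1 ?eqxx// => y _.
  by apply/eqP; apply: contra_notT ne => ?; exists y.
rewrite mulf_eq0 negb_or => /andP[/Jfield_deg[l tl ->] /IHk[sd sumd]].
rewrite -(cat_take_drop i w) tl /= big_cons sumd; split=> //.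
rewrite opprB addrA addrCA -!addrA; congr (_ + _).
by rewrite addrCA [X in _ + X]addrA subrr add0r -PoszD.
Qed.

Lemma mul_t_weight (A : lmodType rat) (ts : seq posnat) (f : series A) mu :
  act_word [seq inl n | n <- ts] f mu != 0 ->
  (\sum_(n <- ts) val n <= weight mu)%N.
Proof.
elim: ts mu => [|n ts IHts] mu /=; first by rewrite big_nil.
rewrite /mul_t; case: ifP => [nmu /IHts le|_]; last by rewrite eqxx.
rewrite big_cons.
have -> : weight mu = (val n + weight (mu `\ n)%mset)%N.
  rewrite /weight; transitivity
    (\sum_(a <- n :: enum_mset (mu `\ n)%mset) val a)%N; last by rewrite big_cons.
  apply: perm_big; apply/allP => /= a _ /=.
  rewrite !count_mem_mset msetE2 msetnE [n == a]eq_sym.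
  case: (a =P n) => [->|_]; last by rewrite subn0.
  by rewrite add1n subn1 prednK // -in_mset.
by rewrite leq_add2l.
Qed.

Lemma bounded_words_finite (K B : nat) :
  finite_set [set w : word | (size w <= K)%N /\
     forall l, l \in w -> (absz (ldeg l) <= B)%N]%classic.
Proof.
pose dec (o : option (bool * 'I_B.+1)) : option letter :=
  if o is Some (b, i) then
    omap (fun n : posnat => if b then inl n else inr n) (insub (i : nat))
  else None.
pose enc (l : letter) : option (bool * 'I_B.+1) :=
  Some (is_t l, inord (absz (ldeg l))).
have encK l : (absz (ldeg l) <= B)%N -> dec (enc l) = Some l.
  by case: l => n /=; rewrite ?abszN /= => le; rewrite inordK // valK.
have decN : dec None = None by [].
clearbody dec enc; apply: (@sub_finite_set _ _
  ((fun t : K.-tuple _ => pmap dec t) @` [set: _])%classic); last first.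
  by apply: finite_image; exact: finite_finset.
move=> w /= [sw bw]; pose s := map enc w ++ nseq (K - size w) None.
have ss : size s == K by rewrite size_cat size_map size_nseq subnKC.
exists (Tuple ss) => //=; rewrite pmap_cat.
have -> : pmap dec (nseq (K - size w) None) = [::].
  by elim: (K - size w)%N => //= n ->; rewrite decN.
rewrite cats0; elim: w bw {sw s ss} => //= l w IHw bw.
rewrite (encK l) /= ?bw ?mem_head // IHw // => l' l'w.
by apply: bw; rewrite inE l'w orbT.
Qed.

Lemma Pop_support (A : lmodType rat) (k : nat) (m : int) (f : series A) mu :
  (0 < k)%N ->
  finite_set [set w | Pfield k (- m - k%:Z) w *:
                      act_word (normal_order w) f mu != 0]%classic.
Proof.
move=> k0; apply: sub_finite_set (bounded_words_finite k (weight mu + absz m)).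
move=> w /=; rewrite scaler_eq0 negb_or => /andP[/(Pfield_deg k0)[sw]].
rewrite subrK => degw nz; split=> // l lw.
pose T := (\sum_(l <- w | is_t l) absz (ldeg l))%N.
pose D := (\sum_(l <- w | ~~ is_t l) absz (ldeg l))%N.
have TD : T%:Z - D%:Z = - m.
  rewrite -degw (bigID is_t) /= /T /D !(big_morph Posz PoszD (erefl _)) -sumrN.
  by congr (_ + _); apply: eq_bigr => -[n|n] //=; rewrite abszN.
have leT : (T <= weight mu)%N.
  have [ts wts] : exists ts, filter is_t w = [seq inl n | n <- ts].
    elim: (w) => [|[n|n] w' [ts e]] /=; first by exists [::].
    - by exists (n :: ts); rewrite e.
    - by exists ts.
  move: nz; rewrite /normal_order /act_word foldr_cat wts => /mul_t_weight le.
  by rewrite /T -big_filter wts big_map.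
have leD : (D <= weight mu + absz m)%N.
  rewrite -lez_nat PoszD; have -> : D%:Z = T%:Z + m.
    by rewrite -[m]opprK -TD opprB addrC subrK.
  by apply: lerD; rewrite ?lez_nat // lez_abs.
have le_l (P : pred letter) : P l ->
    (absz (ldeg l) <= \sum_(l <- w | P l) absz (ldeg l))%N.
  by move=> Pl; rewrite (big_rem l) //= Pl leq_addr.
have [tl|tl] := boolP (is_t l).
- by apply: leq_trans (le_l _ tl) (leq_trans leT (leq_addr _ _)).
- exact: leq_trans (le_l (fun l => ~~ is_t l) tl) leD.
Qed.

(* Main.v *)
(* The coefficient of s^d / d! of Z_(r) in the variables t_n is the sum of
   v_1^(cycles of x_1) ... v_r^(cycles of x_r) p_(type of x_1 ... x_r) over
   x_1, ..., x_r in S_d. Write x_i = tau_i b_i, where b_i fixes the last point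
   and tau_i is the identity or moves the last point. Moving the b_i to the
   right makes the sum over the tau_i a product of factors v_i + X, X being the
   Jucys-Murphy element of the last point. Since X is the difference of the
   central sums of transpositions of S_d and S_(d-1), each X acts on symmetric
   functions as the commutator ad(D) with the cut-and-join operator D, and the
   step from d - 1 to d is prod_i (ad(D) + v_i) applied to p_1.

   On the bosonic side let Q_k = P^(k)_{-1} / k!. Then
   [D, Q_k] = k Q_(k+1) + (k - 1) Q_k, i.e.
   ad(D) (ad(D) - 1) ... (ad(D) - k + 1) (p_1) = k! Q_(k+1), and the defining
   identity of the a_k turns prod_i (ad(D) + v_i) (p_1) into sum_k a_k P^(k)_{-1}.
   The commutator is computed on the generating series of the Q_k. An operator
   family is determined by its brackets with the currents J_n and its constant
   terms; taking brackets with J_n reduces D to the quadratic operators L_n, and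
   these to the currents. *)
Require Import Defs.
From HB Require Import structures.
From mathcomp Require Import all_boot all_order all_algebra all_fingroup.
From mathcomp Require Import finmap multiset.
From mathcomp Require Import boolp classical_sets functions cardinality fsbigop.
From mathcomp Require Import mpoly.
From mathcomp Require Import ring zify.
Set Implicit Arguments.
Unset Strict Implicit.
Unset Printing Implicit Defensive.
Import Order.TTheory GRing.Theory Num.Theory.
Local Open Scope ring_scope.

(** Dividing P^(k) by k! turns the recursion of the fields into a single first-order equation, theta
    E = :J E: - deg E, for E = sum_k u^k Q_k, where theta = q d/dq and q = 1 + u. It yields [J_l, E]
    = (q^l - 1) E. Only degree -1 is wanted, but a bracket with J_l shifts degrees, so the
    commutator with D is found in every degree m: u [D, E_m] = m E_m - u m theta(E_m) - (u/2) m (m -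
    1) E_m. A similar formula for the quadratic operators comes before it, since [J_l, D] is a
    multiple of one of them. In both cases the difference of the two sides has the same brackets
    with the currents as E and zero constant terms; such a family vanishes, by induction on the
    power of u and on the number of factors p_n of the argument. This induction gives the formulas
    on polynomials, which is enough, each coefficient of s^d being a polynomial. Negative powers of
    q are avoided by writing l = c - d and multiplying by q^d. *)

(** * Currents *)

(* Decides identities between signed sums in an abelian group. *)
Ltac zmod :=
  apply/eqP; rewrite -subr_eq0 ?(opprD, opprK, opprB, addrA);
  repeat match goal with |- context [- ?x] =>
    repeat match goal with |- context [?a + ?b + x] =>
      tryif constr_eq b x then fail else rewrite (addrAC a b x) end;
    try match goal with |- context [?a + x] =>
      tryif constr_eq a x then fail else rewrite (addrC a x) end;
    repeat match goal with |- context [?a + ?b - x] =>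
      tryif constr_eq b (- x) then fail else rewrite (addrAC a b (- x)) end;
    rewrite subrr ?add0r
  end; rewrite ?addr0 ?eqxx.

(* [lmod x] collects the coefficients of x in an identity of a module over a
   commutative ring and proves that their sum vanishes. *)
Ltac lmod_start :=
  apply/eqP; rewrite -subr_eq0
    ?(scalerDr, scalerBr, scalerN, scalerA, opprD, opprK, opprB, addrA, =^~ scaleNr).
Ltac lmod_pull x :=
  repeat match goal with |- context [?a + ?b + ?r *: x] =>
    lazymatch b with _ *: x => fail | _ => rewrite (addrAC a b (r *: x)) end end.
Ltac lmod x :=
  lmod_pull x;
  try (match goal with |- context [?a + ?r *: x] =>
    lazymatch a with _ + _ => fail | _ *: x => fail
    | _ => rewrite (addrC a (r *: x)) end end; lmod_pull x);
  repeat match goal with |- context [?r *: x + ?r' *: x] =>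
    rewrite -(scalerDl x r r') end;
  match goal with |- context [?r *: x] =>
    rewrite (_ : r = 0); [rewrite scale0r ?add0r | try ring] end.

Lemma weight_mset1D (n : posnat) (mu : ipartition) :
  weight (n +` mu)%mset = (val n + weight mu)%N.
Proof.
rewrite /weight; transitivity (\sum_(a <- n :: enum_mset mu) val a)%N; last by rewrite big_cons.
apply: perm_big; apply/allP => /= a _ /=.
by rewrite !count_mem_mset mset1DE [n == a]eq_sym.
Qed.

Lemma weight_msetB1 (n : posnat) (mu : ipartition) :
  n \in mu -> weight mu = (val n + weight (mu `\ n)%mset)%N.
Proof. by move=> nmu; rewrite -weight_mset1D msetB1K. Qed.

HB.instance Definition _ (A : lmodType rat) :=
  GRing.Lmodule.copy (series A) (ipartition -> A).

Section Series.
Variable A : lmodType rat.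
Implicit Types f g : series A.

Lemma seriesD f g mu : (f + g) mu = f mu + g mu. Proof. by []. Qed.

Lemma seriesN f mu : (- f) mu = - f mu. Proof. by []. Qed.

Lemma seriesZ (c : rat) f mu : (c *: f) mu = c *: f mu. Proof. by []. Qed.

Lemma series_sum (I : Type) (r : seq I) (P : pred I) (F : I -> series A) mu :
  (\sum_(i <- r | P i) F i) mu = \sum_(i <- r | P i) F i mu.
Proof. exact: (big_morph (fun f : series A => f mu)). Qed.

Definition seriesE := (seriesD, seriesN, seriesZ).

End Series.

Section Letters.
Variable A : lmodType rat.
Implicit Types f : series A.

Lemma mul_tC n m f : mul_t n (mul_t m f) = mul_t m (mul_t n f).
Proof.
have [-> //|nm] := eqVneq n m; apply/funext => mu; rewrite /mul_t.
rewrite !in_msetB1 (negPf nm) [m == n]eq_sym (negPf nm) /=.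
case: (n \in mu); case: (m \in mu) => //; congr f.
by apply/msetP => a; rewrite !msetB1E subnAC.
Qed.

Lemma diff_tC n m f : diff_t n (diff_t m f) = diff_t m (diff_t n f).
Proof.
have [-> //|nm] := eqVneq n m; apply/funext => mu; rewrite /diff_t.
rewrite !mset1DE (negPf nm) [m == n]eq_sym (negPf nm) /= !add0n -!mulrnA mulnC.
by congr (f _ *+ _); rewrite msetDCA.
Qed.

Lemma diff_mul_t n m f :
  diff_t n (mul_t m f) = mul_t m (diff_t n f) + (if n == m then f else 0).
Proof.
apply/funext => mu; rewrite seriesD /diff_t /mul_t in_mset1D.
have [<-|nm] := eqVneq n m.
  rewrite msetD1K /=; case: ifP => nmu.
    by rewrite msetB1K // msetB1E eqxx subn1 prednK -?in_mset // mulrSr.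
  by rewrite (mset_eq0P _) ?nmu // add0r mulr1n.
rewrite addr0 /=; case: ifP => mmu; last by rewrite mul0rn.
rewrite msetB1E (negPf nm) subn0; congr (f _ *+ _).
by apply/msetP => a; rewrite !(msetB1E, mset1DE); case: (eqVneq a n) => [->|_];
  rewrite ?add0n // (negPf nm) !subn0.
Qed.

End Letters.

Section Currents.
Variable A : lmodType rat.
Local Notation V := (series A).
Implicit Types (f g : V) (mu nu : ipartition).

(* J_n = d/dt_n, J_{-n} = n t_n for n > 0, and J_0 = 0. *)
Definition current (l : int) f : V :=
  match l with
  | Posz n => if insub n is Some p then diff_t p f else 0
  | Negz n => if insub n.+1 is Some p then n.+1%:R *: (mul_t p f : V) else 0
  end.
Arguments current : simpl never.

Fact current_is_linear l : linear (current l).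
Proof.
case: l => n c f g; rewrite /current; case: insub => [p|];
  rewrite ?scaler0 ?addr0 //; apply/funext => mu;
  rewrite !seriesE /diff_t /mul_t !seriesE.
  by rewrite mulrnDl scalerMnr.
by case: ifP => _; rewrite ?scaler0 ?addr0 // scalerDr !scalerA mulrC.
Qed.
HB.instance Definition _ l :=
  GRing.isLinear.Build rat V V *:%R (current l) (current_is_linear l).

Lemma current_Negz (p : posnat) f :
  current (- (val p)%:Z) f = (val p)%:R *: (mul_t p f : V).
Proof.
by case: p => -[//|n] n0; rewrite /current /= insubT.
Qed.

Lemma current_Posz (p : posnat) f : current (val p)%:Z f = diff_t p f.
Proof. by rewrite /current valK. Qed.

Lemma current0 f : current 0 f = 0.
Proof. by rewrite -[0 in LHS]/(Posz 0) /current insubF. Qed.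

Variant current_spec : int -> Type :=
  | CurrentPos (p : posnat) : current_spec (val p)%:Z
  | CurrentNeg (p : posnat) : current_spec (- (val p)%:Z)
  | Current0 : current_spec 0.

Lemma currentP l : current_spec l.
Proof.
case: l => [[|n]|n]; first exact: Current0.
  exact: (CurrentPos (exist _ n.+1 (isT : (0 < n.+1)%N))).
by rewrite NegzE; exact: (CurrentNeg (exist _ n.+1 (isT : (0 < n.+1)%N))).
Qed.

Lemma current_local l f g mu :
  (forall nu, (weight nu)%:Z = (weight mu)%:Z + l -> f nu = g nu) ->
  current l f mu = current l g mu.
Proof.
case: (currentP l) => [p|p|]; rewrite ?current0 // ?current_Posz ?current_Negz.
  by move=> fg; rewrite /diff_t fg // weight_mset1D; lia.
move=> fg; rewrite !seriesZ /mul_t; case: ifP => // pmu.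
by rewrite fg // (weight_msetB1 pmu); lia.
Qed.

Lemma current_eq0 l f mu : (weight mu)%:Z + l < 0 -> current l f mu = 0.
Proof.
move=> lt0; transitivity (current l 0 mu); last by rewrite linear0.
by apply: current_local => nu; lia.
Qed.

Lemma currentC a b f :
  current a (current b f) - current b (current a f)
    = if a + b == 0 then a%:~R *: f else 0.
Proof.
case: (currentP a) => [p|p|]; case: (currentP b) => [r|r|];
  rewrite ?current0 ?linear0 ?subrr ?oppr0 ?addr0 ?add0r ?scale0r ?if_same //.
- by rewrite !current_Posz diff_tC subrr; case: p => -[|p] hp; case: r => -[|r] hr.
- rewrite !current_Negz linearZ /= !current_Posz diff_mul_t.
  rewrite scalerDr addrC addKr subr_eq0 eqz_nat (inj_eq val_inj) pmulrn.
  by case: eqP => [->|_] //; rewrite scaler0.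
- by case: p => -[|p] hp.
- rewrite !current_Negz linearZ /= !current_Posz diff_mul_t.
  rewrite scalerDr opprD addrA subrr add0r addrC subr_eq0 eqz_nat (inj_eq val_inj).
  by rewrite eq_sym; case: eqP => [->|_] //; rewrite ?scaler0 ?oppr0 // -scaleNr mulrNz pmulrn.
- rewrite (current_Negz r f) (current_Negz p f) !linearZ /= !current_Negz !scalerA.
  rewrite scalerN scalerA mulrC (mul_tC p r f : _ = _ :> V) subrr.
  by case: p => -[|p] hp; case: r => -[|r] hr.
- by case: p => -[|p] hp //; rewrite oppr0.
Qed.

End Currents.
Arguments current : simpl never.

(* Families of operators indexed by their degree. *)
Definition fam (A : lmodType rat) : Type := int -> series A -> series A.

HB.instance Definition _ (A : lmodType rat) :=
  GRing.Lmodule.copy (fam A) (int -> series A -> series A).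

Section NormalOrder.
Variable A : lmodType rat.
Local Notation V := (series A).
Implicit Types (f g : V) (mu nu : ipartition) (X Y : fam A).

(** The second clause is locality: the value at [mu] depends on the argument in one weight only. On
    infinite series this is what makes the sums in [nord] finite at each monomial. *)
Definition graded X : Prop :=
  (forall m, linear (X m)) /\
  (forall m f g mu,
     (forall nu, (weight nu)%:Z = (weight mu)%:Z + m -> f nu = g nu) ->
     X m f mu = X m g mu).

Lemma graded0 X m : graded X -> X m 0 = 0.
Proof.
move=> [+ _] => /(_ m (-1) 0 0).
by rewrite scaler0 addr0 scaleN1r addNr.
Qed.

Lemma gradedZ X m c f : graded X -> X m (c *: f) = c *: X m f.
Proof.
move=> gX; have := gX.1 m c f 0; rewrite addr0 => ->.
by rewrite graded0 // addr0.
Qed.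

Lemma gradedD X m f g : graded X -> X m (f + g) = X m f + X m g.
Proof. by move=> gX; have := gX.1 m 1 f g; rewrite !scale1r. Qed.

Lemma gradedB X m f g : graded X -> X m (f - g) = X m f - X m g.
Proof. by move=> gX; rewrite -!scaleN1r gradedD // gradedZ. Qed.

Lemma graded_sum X m (I : Type) (r : seq I) (F : I -> V) : graded X ->
  X m (\sum_(i <- r) F i) = \sum_(i <- r) X m (F i).
Proof.
move=> gX; apply: (big_morph (X m)); last exact: graded0.
by move=> f g; rewrite gradedD.
Qed.

Lemma graded_eq0 X m f mu :
  graded X -> (weight mu)%:Z + m < 0 -> X m f mu = 0.
Proof.
move=> gX lt0; rewrite (gX.2 m f 0 mu) ?graded0 // => nu.
by lia.
Qed.

Lemma graded_current : graded (@current A).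
Proof. by split=> [m|m f g mu]; [exact: linearP | exact: current_local]. Qed.

(** For [z] of degree [n], the shift by [n] indexes the bracket by its total degree, so that it is
    again a family. *)
Definition comm (z : V -> V) (n : int) X : fam A :=
  fun m f => z (X (m - n) f) - X (m - n) (z f).

Local Notation commJ l := (comm (@current A l) l).

Lemma graded_commJ l X : graded X -> graded (commJ l X).
Proof.
move=> gX; split=> [m c f g|m f g mu fg]; rewrite /comm.
  rewrite linearP /= !gX.1 linearP /= scalerBr opprD addrACA.
  by rewrite -scalerN.
rewrite !seriesE; congr (_ - _).
  by apply: current_local => nu hnu; apply: gX.2 => nu' hnu'; apply: fg; lia.
by apply: gX.2 => nu hnu; apply: current_local => nu' hnu'; apply: fg; lia.
Qed.

(** The raising half of J stands to the left of [X] and the lowering half to its right; J_0 = 0. *)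
Definition nord_upto (B : nat) X m f : V :=
  \sum_(1 <= n < B.+1)
    (current (- n%:Z) (X (m + n%:Z) f) + X (m - n%:Z) (current n%:Z f)).

(* The normally ordered product of J and X. All terms with n larger than the
   bound vanish at mu. *)
Definition nord X : fam A := fun m f mu => nord_upto (weight mu + absz m) X m f mu.

Lemma nord_uptoE B X m f mu : graded X -> (weight mu + absz m <= B)%N ->
  nord X m f mu = nord_upto B X m f mu.
Proof.
move=> gX leB; rewrite /nord /nord_upto.
rewrite [in RHS](big_cat_nat (n := (weight mu + absz m).+1)) //=.
rewrite seriesD [X in _ = _ + X](_ : _ = 0) ?addr0 //.
rewrite series_sum big_nat_cond big1 // => n /andP[/andP[lt_n _] _].
by rewrite seriesD current_eq0 ?graded_eq0 ?addr0 //; lia.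
Qed.

Lemma graded_nord X : graded X -> graded (nord X).
Proof.
move=> gX; split=> [m c f g|m f g mu fg].
  apply/funext => mu; rewrite /nord.
  transitivity (c *: nord X m f mu + nord X m g mu) => //.
  rewrite /nord /nord_upto !series_sum scaler_sumr -big_split /=.
  apply: eq_bigr => n _; rewrite !gX.1 !linearP /= gX.1 !seriesE.
  by rewrite addrACA scalerDr.
rewrite /nord /nord_upto !series_sum; apply: eq_bigr => n _; rewrite !seriesD; congr (_ + _).
  by apply: current_local => nu hnu; apply: gX.2 => nu' hnu'; apply: fg; lia.
by apply: gX.2 => nu hnu; apply: current_local => nu' hnu'; apply: fg; lia.
Qed.

(** A derivation rule: besides its bracket with [X], J_l meets the factor J_{-l} of the product, and
    [J_l, J_{-l}] = l. *)
Lemma commJ_nord l X m f : graded X ->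
  commJ l (nord X) m f = nord (commJ l X) m f + l%:~R *: X m f.
Proof.
move=> gX; apply/funext => mu.
(* Large enough for all three truncations, whose weights and degrees are shifted by [l], and for
   [absz l] to occur among the indices. *)
pose B := (weight mu + absz m + 3 * absz l)%N.
rewrite [commJ l (nord X) m f]/comm !seriesE.
have -> : current l (nord X (m - l) f) mu = current l (nord_upto B X (m - l) f) mu.
  apply: current_local => nu hnu; apply: nord_uptoE => //.
  by rewrite /B; lia.
rewrite (nord_uptoE (B := B)) //; last by rewrite /B; lia.
rewrite (nord_uptoE (B := B)) //; [|exact: graded_commJ|by rewrite /B; lia].
suff: current l (nord_upto B X (m - l) f) - nord_upto B X (m - l) (current l f)
      = nord_upto B (commJ l X) m f + l%:~R *: X m f by move/(congr1 (@^~ mu)).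
 rewrite /nord_upto linear_sum -sumrB /=; apply/eqP.
rewrite -subr_eq0 opprD addrA -sumrB subr_eq0; apply/eqP.
(* [G n] collects the central terms of [J_l, J_{-n}] and [J_l, J_n]; it can be nonzero only at n =
   |l|. *)
pose G (n : nat) : V := (if l - n%:Z == 0 then l%:~R *: X m f else 0) +
             (if l + n%:Z == 0 then l%:~R *: X m f else 0).
transitivity (\sum_(1 <= n < B.+1) G n).
  apply: eq_big_nat => n /andP[n0 _]; rewrite /comm linearD /=.
  have e1 : m + n%:Z - l = m - l + n%:Z by lia.
  have e2 : m - n%:Z - l = m - l - n%:Z by lia.
  rewrite e1 e2 linearB /=.
  have c1 := currentC l (- n%:Z) (X (m - l + n%:Z) f).
  have c2 := currentC l n%:Z f.
  have -> : G n = (current l (current (- n%:Z) (X (m - l + n%:Z) f)) -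
     current (- n%:Z) (current l (X (m - l + n%:Z) f))) +
     X (m - l - n%:Z) (current l (current n f) - current n (current l f)).
    rewrite c1 c2 /G; congr (_ + _); first by case: eqP => // h; congr (_ *: X _ f); lia.
    by case: eqP => // h; rewrite ?graded0 ?gradedZ //; congr (_ *: X _ f); lia.
  rewrite gradedB //.
  by zmod.
have [l0|l0] := eqVneq l 0.
  by rewrite l0 scale0r big1 // => n _; rewrite /G l0 scale0r !if_same addr0.
rewrite /G (bigD1_seq (absz l)) ?iota_uniq ?mem_index_iota //=; last by rewrite /B; lia.
rewrite big1 => [|n nl]; last by rewrite !ifF ?addr0 //; lia.
case: l l0 {B G} => n n0; rewrite ?NegzE ?abszN /=.
  by rewrite subrr eqxx ifF ?addr0 //; lia.
by rewrite add0r addNr eqxx addr0.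
Qed.
End NormalOrder.

(** * Power series with coefficients in a module *)

(* Formal power series in u with coefficients in M, as a module over the
   polynomials in u; q stands for 1 + u and theta for q d/dq = (1 + u) d/du. *)
Definition pseq (M : lmodType rat) : Type := nat -> M.

Section PowerSeries.
Variable M : lmodType rat.
Implicit Types (p : {poly rat}) (s : pseq M).

HB.instance Definition _ := GRing.Zmodule.copy (pseq M) (nat -> M).

Lemma pseqD s t k : (s + t) k = s k + t k. Proof. by []. Qed.

Lemma pseqN s k : (- s) k = - s k. Proof. by []. Qed.

Lemma pseq_sum (I : Type) (r : seq I) (P : pred I) (F : I -> pseq M) k :
  (\sum_(i <- r | P i) F i) k = \sum_(i <- r | P i) F i k.
Proof. exact: (big_morph (fun s : pseq M => s k)). Qed.

Definition pscale p s : pseq M :=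
  fun k => \sum_(0 <= i < k.+1) p`_i *: s (k - i)%N.

Fact pscaleA p1 p2 s : pscale p1 (pscale p2 s) = pscale (p1 * p2) s.
Proof.
apply/funext => k; rewrite /pscale.
transitivity (\sum_(0 <= i < k.+1) \sum_(0 <= n < k.+1 | (i <= n)%N)
    (p1`_i * p2`_(n - i)) *: s (k - n)%N).
  apply: eq_big_nat => i /andP[_ ik]; rewrite scaler_sumr.
  rewrite [RHS](big_cat_nat (n := i)) ?(ltnW ik) //=.
  rewrite [X in _ = X + _]big_nat_cond [X in _ = X + _]big_pred0 ?add0r; last first.
    by move=> n; apply: contraTF isT => /andP[]; lia.
  symmetry; rewrite -[X in \sum_(X <= _ < _ | _) _]add0n big_addn subSn //.
  rewrite [RHS]big_nat_cond.
  rewrite [LHS]big_nat_cond; apply: eq_big => [n|n _]; first by lia.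
  by rewrite scalerA addnK; congr (_ *: s _); lia.
rewrite (exchange_big_dep_nat xpredT) //=; apply: eq_big_nat => n /andP[_ nk].
rewrite coefM -scaler_suml; congr (_ *: _).
rewrite -(big_mkord xpredT (fun i => p1`_i * p2`_(n - i))).
rewrite [LHS](big_cat_nat (n := n.+1)) //= [X in _ + X]big_nat_cond.
rewrite [X in _ + X]big_pred0 ?addr0; last first.
  by move=> i; apply: contraTF isT => /andP[]; lia.
by rewrite big_nat_cond [RHS]big_nat_cond; apply: eq_bigl => i; lia.
Qed.

Fact pscale1 : left_id 1 pscale.
Proof.
move=> s; apply/funext => k; rewrite /pscale big_nat_recl // coef1 scale1r subn0.
by rewrite big1_seq ?addr0 // => i _; rewrite coef1 scale0r.
Qed.

Fact pscaleDr : right_distributive pscale +%R.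
Proof.
move=> p s t; apply/funext => k; rewrite [RHS]pseqD /pscale -big_split /=.
by apply: eq_bigr => i _; rewrite -scalerDr.
Qed.

Fact pscaleDl s : {morph pscale^~ s : a b / a + b}.
Proof.
move=> p1 p2; apply/funext => k; rewrite [RHS]pseqD /pscale -big_split /=.
by apply: eq_bigr => i _; rewrite coefD scalerDl.
Qed.

HB.instance Definition _ := GRing.Zmodule_isLmodule.Build {poly rat} (pseq M)
  pscaleA pscale1 pscaleDr pscaleDl.

Lemma pscaleE p s k : (p *: s) k = \sum_(0 <= i < k.+1) p`_i *: s (k - i)%N.
Proof. by []. Qed.

Lemma pscale0E p s : (p *: s) 0%N = p`_0 *: s 0%N.
Proof. by rewrite pscaleE big_nat1. Qed.

Lemma pscaleC c s k : (c%:P *: s) k = c *: s k.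
Proof.
rewrite pscaleE big_nat_recl // coefC subn0 big1_seq ?addr0 // => i _.
by rewrite coefC scale0r.
Qed.

Lemma pscaleX s k : ('X *: s) k = if k is k'.+1 then s k' else 0.
Proof.
rewrite pscaleE; case: k => [|k]; first by rewrite big_nat1 coefX scale0r.
rewrite !big_nat_recl // !coefX scale0r add0r scale1r subn1 big1_seq ?addr0 //.
by move=> i _; rewrite coefX scale0r.
Qed.

Definition theta s : pseq M := fun k => k.+1%:R *: s k.+1 + k%:R *: s k.

Fact theta_is_additive : zmod_morphism theta.
Proof.
move=> s t; apply/funext => k; rewrite /theta !(pseqD, pseqN) !scalerBr.
by zmod.
Qed.
HB.instance Definition _ :=
  GRing.isZmodMorphism.Build (pseq M) (pseq M) theta theta_is_additive.

Lemma thetaD s t : theta (s + t) = theta s + theta t.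
Proof. exact: raddfD. Qed.

Lemma thetaB s t : theta (s - t) = theta s - theta t.
Proof. exact: raddfB. Qed.

Lemma thetaX s : theta ('X *: s) = 'X *: theta s + (1 + 'X) *: s.
Proof.
apply/funext => -[|k]; rewrite scalerDl scale1r !pseqD !pscaleX /theta !pscaleX.
  by rewrite scaler0 scale1r !addr0 add0r.
by rewrite -[k.+2%:R]natr1 -![k.+1%:R]natr1 !scalerDl !scale1r; zmod.
Qed.

(** Powers of q are eigenvectors of theta, with eigenvalue the exponent. *)
Lemma theta_expq a s :
  theta ((1 + 'X) ^+ a *: s)
    = (1 + 'X) ^+ a *: theta s + (a%:R * (1 + 'X) ^+ a) *: s.
Proof.
elim: a s => [|a IHa] s; first by rewrite expr0 mul0r !scale1r scale0r addr0.
have e1 : theta ((1 + 'X) *: s) = (1 + 'X) *: theta s + (1 + 'X) *: s.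
  by rewrite [in LHS]scalerDl thetaD thetaX scale1r addrA [(1 + 'X) *: theta s]scalerDl scale1r.
rewrite exprSr -scalerA IHa e1 scalerDr !scalerA -addrA -scalerDl.
by congr (_ *: _ + _ *: _); ring.
Qed.

End PowerSeries.

Section Map.
Variables (M M' : lmodType rat) (F : {linear M -> M'}).
Implicit Types (p : {poly rat}) (s : pseq M).

Definition pseq_map s : pseq M' := fun k => F (s k).

Fact pseq_map_is_linear : linear_for ( *:%R : {poly rat} -> _) pseq_map.
Proof.
move=> p s t; apply/funext => k; rewrite /pseq_map !pseqD raddfD; congr (_ + _).
by rewrite !pscaleE raddf_sum /=; apply: eq_bigr => i _; rewrite linearZ.
Qed.
HB.instance Definition _ := GRing.isLinear.Build {poly rat} (pseq M) (pseq M')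
  *:%R pseq_map pseq_map_is_linear.

Lemma pseq_mapE s k : pseq_map s k = F (s k). Proof. by []. Qed.

Lemma pseq_mapB s t : pseq_map (s - t) = pseq_map s - pseq_map t.
Proof. exact: linearB. Qed.

Lemma pseq_mapD s t : pseq_map (s + t) = pseq_map s + pseq_map t.
Proof. exact: linearD. Qed.

Lemma pseq_mapZ p s : pseq_map (p *: s) = p *: pseq_map s.
Proof. exact: linearZ. Qed.

Lemma pseq_map_theta s : pseq_map (theta s) = theta (pseq_map s).
Proof. by apply/funext => k; rewrite /pseq_map /theta linearD /= !linearZ. Qed.

End Map.

(** * The fields P^(k) *)

Section Families.
Variable A : lmodType rat.
Local Notation V := (series A).
Local Notation fam := (fam A).
Implicit Types (f g : V) (mu nu : ipartition) (X Y : fam).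
Local Notation commJ l := (comm (@current A l) l).

Lemma famD X Y m f : (X + Y) m f = X m f + Y m f. Proof. by []. Qed.

Lemma famN X m f : (- X) m f = - X m f. Proof. by []. Qed.

Lemma famZ c X m f : (c *: X) m f = c *: X m f. Proof. by []. Qed.

Fact comm_is_linear (z : {linear V -> V}) n : linear (comm z n : fam -> fam).
Proof.
move=> c X Y; apply/funext => m; apply/funext => f.
rewrite famD famZ /comm !famD !famZ linearP /= scalerBr.
by rewrite opprD addrACA.
Qed.
HB.instance Definition _ (z : {linear V -> V}) n :=
  GRing.isLinear.Build rat fam fam *:%R (comm z n) (comm_is_linear z n).
Definition commL (z : {linear V -> V}) n : {linear fam -> fam} := comm z n.

Fact nord_is_linear : linear (@nord A).
Proof.
move=> c X Y; apply/funext => m; apply/funext => f; apply/funext => mu.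
transitivity (c *: nord X m f mu + nord Y m f mu) => //.
rewrite /nord /nord_upto !fct_sumE scaler_sumr -big_split /=.
apply: eq_bigr => n _; rewrite !famD !famZ linearP /=.
by rewrite !seriesE scalerDr addrACA.
Qed.
HB.instance Definition _ :=
  GRing.isLinear.Build rat fam fam *:%R (@nord A) nord_is_linear.
Definition nordL : {linear fam -> fam} := @nord A.

Definition fdeg X : fam := fun m f => m%:~R *: X m f.

Fact fdeg_is_linear : linear fdeg.
Proof.
move=> c X Y; apply/funext => m; apply/funext => f.
by rewrite famD famZ /fdeg famD famZ scalerDr !scalerA mulrC.
Qed.
HB.instance Definition _ :=
  GRing.isLinear.Build rat fam fam *:%R fdeg fdeg_is_linear.
Definition fdegL : {linear fam -> fam} := fdeg.

Lemma fdeg_comm (z : {linear V -> V}) n X :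
  comm z n (fdeg X) = fdeg (comm z n X) - n%:~R *: comm z n X.
Proof.
apply/funext => m; apply/funext => f.
rewrite famD famN famZ /fdeg /comm linearZ /= -scalerBr.
by rewrite -scalerBl -rmorphB.
Qed.

Lemma gradedDf X Y : graded X -> graded Y -> graded (X + Y).
Proof.
move=> gX gY; split=> [m c f g|m f g mu fg]; rewrite !famD.
  by rewrite gX.1 gY.1 scalerDr addrACA.
by rewrite !seriesD (gX.2 _ _ _ _ fg) (gY.2 _ _ _ _ fg).
Qed.

Lemma gradedZf c X : graded X -> graded (c *: X).
Proof.
move=> gX; split=> [m d f g|m f g mu fg]; rewrite !famZ.
  by rewrite gX.1 scalerDr !scalerA mulrC.
by rewrite !seriesZ (gX.2 _ _ _ _ fg).
Qed.

Lemma graded_fdeg X : graded X -> graded (fdeg X).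
Proof.
move=> gX; split=> [m d f g|m f g mu fg]; rewrite /fdeg.
  by rewrite gX.1 scalerDr !scalerA mulrC.
by rewrite !seriesZ (gX.2 _ _ _ _ fg).
Qed.

Definition fone : fam := fun m f => if m == 0 then f else 0.

Lemma graded_fone : graded fone.
Proof.
split=> [m d f g|m f g mu fg]; rewrite /fone; case: eqP => // m0.
  by rewrite scaler0 addr0.
by apply: fg; rewrite m0 addr0.
Qed.

Lemma commJ_fone l : commJ l fone = 0.
Proof.
apply/funext => m; apply/funext => f; rewrite /comm /fone.
by case: eqP => _; [rewrite subrr | rewrite linear0 subrr].
Qed.

Definition Jpow k : fam := iter k (@nord A) fone.

Lemma graded_Jpow k : graded (Jpow k).
Proof. by elim: k => [|k]; [exact: graded_fone | exact: graded_nord]. Qed.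

HB.instance Definition _ k n :=
  GRing.isLinear.Build rat V V *:%R (Jpow k n) ((graded_Jpow k).1 n).

Lemma commJ_Jpow l k : commJ l (Jpow k.+1) = (k.+1%:R * l%:~R) *: Jpow k.
Proof.
elim: k => [|k IHk]; apply/funext => m; apply/funext => f.
  rewrite commJ_nord ?commJ_fone; last exact: graded_fone.
  by rewrite linear0 mul1r add0r.
rewrite -[Jpow k.+2]/(nord (Jpow k.+1)) commJ_nord; last exact: (graded_Jpow k.+1).
rewrite IHk linearZ /= -[nord _]/(Jpow k.+1) !famZ -scalerDl.
by congr (_ *: _); rewrite -[k.+2%:R]natr1 mulrDl mul1r.
Qed.

Lemma Jpow1 : Jpow 1 = @current A.
Proof.
apply/funext => m; apply/funext => f; apply/funext => mu.
rewrite /= (nord_uptoE (B := (weight mu + absz m)%N)) //; last exact: graded_fone.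
rewrite /nord_upto /fone.
have [m0|m0] := eqVneq m 0.
  rewrite m0 current0 big_nat_cond big1 // => n /andP[/andP[n0 _] _].
  by rewrite !ifF ?linear0 ?addr0 //; lia.
rewrite (bigD1_seq (absz m)) ?iota_uniq ?mem_index_iota //=; last by lia.
rewrite big_seq_cond big1 => [|n /andP[]]; last first.
  rewrite mem_index_iota => n0 nm.
  by rewrite !ifF ?linear0 ?addr0 //; lia.
case: m m0 => n n0; rewrite ?NegzE ?abszN /= addr0.
  by rewrite subrr eqxx ifF ?linear0 ?add0r //; lia.
by rewrite addNr eqxx addr0.
Qed.

(* Qfam k m = P^(k)_m / k!; the recursion is :(d_z + J) P^(k): read off mode by mode. *)
Fixpoint Qfam k : fam :=
  if k is k'.+1 then
    (k'.+1%:R)^-1 *: (nord (Qfam k') - fdeg (Qfam k') - k'%:R *: Qfam k')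
  else fone.

Lemma graded_Qfam k : graded (Qfam k).
Proof.
elim: k => [|k IHk]; first exact: graded_fone.
apply: gradedZf; rewrite -!scaleN1r scalerA; do 2?apply: gradedDf.
- exact: graded_nord.
- exact/gradedZf/graded_fdeg.
- exact: gradedZf.
Qed.

(* The generating series sum_k u^k P^(k)(z) / k!, i.e. the normally ordered
   exponential of the difference of the bosonic field at z + u and at z. *)
Definition Efam : pseq fam := Qfam.

(** The term k Q_k of the recursion is the difference between theta and d/du; with theta the index k
    disappears from the equation. *)
Lemma theta_Efam : theta Efam = pseq_map nordL Efam - pseq_map fdegL Efam.
Proof.
apply/funext => k; rewrite pseqD pseqN /theta /Efam /= scalerA divff ?pnatr_eq0 //.
by rewrite scale1r subrK.
Qed.

Local Notation q := (1 + 'X : {poly rat}).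

Lemma coef0_q a : (q ^+ a)`_0 = 1.
Proof. by rewrite -horner_coef0 !hornerE expr1n. Qed.

(** This is [J_l, E] = (q^l - 1) E with denominators cleared. The difference [Y] of the two sides
    solves a homogeneous first-order equation in theta and vanishes at u = 0; the equation computes
    each coefficient from the previous one. *)
Lemma commJ_Efam a b : let l := a%:Z - b%:Z in
  q ^+ b *: pseq_map (commL (current l) l) Efam = (q ^+ a - q ^+ b) *: Efam.
Proof.
move=> l; set C := pseq_map _ Efam.
have thC : theta C = pseq_map nordL C - pseq_map fdegL C
                     + (l%:~R)%:P *: Efam + (l%:~R)%:P *: C.
  rewrite -pseq_map_theta theta_Efam pseq_mapB; apply/funext => k.
  have eN : commJ l (nord (Qfam k)) = nord (commJ l (Qfam k)) + l%:~R *: Qfam k.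
    by apply/funext => m; apply/funext => f; rewrite commJ_nord //; exact: graded_Qfam.
  have eH : commJ l (fdeg (Qfam k)) = fdeg (commJ l (Qfam k)) - l%:~R *: commJ l (Qfam k).
    exact: fdeg_comm.
  transitivity (commJ l (nord (Qfam k)) - commJ l (fdeg (Qfam k))); first by [].
  transitivity (nord (commJ l (Qfam k)) - fdeg (commJ l (Qfam k)) + l%:~R *: Qfam k
                + l%:~R *: commJ l (Qfam k)); last by rewrite !(pseqD, pseqN) !pscaleC.
  by rewrite eN eH opprB addrA addrAC; congr (_ + _); exact: addrAC.
have C0 : C 0%N = 0 by exact: commJ_fone.
clearbody C; pose Y := q ^+ b *: C - (q ^+ a - q ^+ b) *: Efam.
have thY : theta Y = pseq_map nordL Y - pseq_map fdegL Y + a%:R *: Y.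
  rewrite /Y [(_ - _) *: Efam]scalerBl !thetaB !theta_expq thC theta_Efam.
  rewrite !pseq_mapB !pseq_mapZ.
  move: (pseq_map _ C) (pseq_map fdegL C) (pseq_map _ Efam) (pseq_map fdegL Efam) => NC HC NE HE.
  move: Efam => E; rewrite /l.
  lmod_start.
  lmod C. lmod NC. lmod HC. lmod NE. lmod HE. lmod E.
  by rewrite eqxx.
suff Y0 k : Y k = 0 by apply/eqP; rewrite -subr_eq0; apply/eqP/funext => k; exact: Y0.
elim: k => [|k IHk].
  rewrite /Y pseqD pseqN !pscale0E coefB !coef0_q subrr scale0r subr0 scale1r; exact: C0.
have := congr1 (@^~ k) thY; rewrite /theta !(pseqD, pseqN) -polyC_natr pscaleC /pseq_map.
have N0 : nord (0 : fam) = 0 by exact: linear0.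
have H0 : fdeg (0 : fam) = 0 by exact: linear0.
rewrite IHk /= N0 H0 subr0 !scaler0 !addr0 => /eqP.
by rewrite scaler_eq0 pnatr_eq0 /= => /eqP.
Qed.
End Families.

(** * Uniqueness of families, and constant terms on constants *)

Section Vacuum.
Variable A : lmodType rat.
Local Notation V := (series A).
Local Notation fam := (fam A).
Implicit Types (f g : V) (mu nu : ipartition) (X Y : fam) (a : A).
Local Notation commJ l := (comm (@current A l) l).
Local Notation adJ l := (commL (@current A l) l).
Local Notation q := (1 + 'X : {poly rat}).
Local Notation E := (@Efam A).

Definition vac a : V := fun mu => if mu == mset0 then a else 0.

(* The product of the p_n = n t_n for n in s, with coefficient a. *)
Definition psum a (s : seq nat) : V :=
  foldr (fun n f => current (- n%:Z) f) (vac a) s.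

Lemma weight0 : weight mset0 = 0%N.
Proof. by rewrite /weight enum_mset0 big_nil. Qed.

Lemma current_vac l a : 0 <= l -> current l (vac a) = 0.
Proof.
case: (currentP l) => [p|p|]; rewrite ?current0 // ?current_Posz.
  move=> _; apply/funext => mu; rewrite /diff_t /vac.
  case: eqP => [e|]; last by rewrite mul0rn.
  by have := in_mset1D p mu p; rewrite e eqxx in_mset0.
by case: p => -[|p] hp //=; lia.
Qed.

Lemma current_mset0 l f : l <= 0 -> current l f mset0 = 0.
Proof.
rewrite le_eqVlt => /predU1P[->|l0]; first by rewrite current0.
by apply: current_eq0; rewrite weight0 add0r.
Qed.

(** The J_l with l > 0 are the derivatives d/dt_l, whose common kernel is the constants. *)
Lemma vac_unique f : (forall l, 0 < l -> current l f = 0) -> f mset0 = 0 -> f = 0.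
Proof.
move=> Jf f0; apply/funext => mu; have [->|[p pmu]] := mset_0Vmem mu; first by rewrite f0.
have /(congr1 (@^~ (mu `\ p)%mset)) : current (val p)%:Z f = 0.
  by apply: Jf; rewrite ltz_nat; exact: valP p.
rewrite current_Posz /diff_t msetB1K // => /eqP.
by rewrite -scaler_nat scaler_eq0 pnatr_eq0 /= => /eqP.
Qed.

Definition evf f X : int -> V := fun m => X m f.

Fact evf_is_linear f : linear (evf f).
Proof. by []. Qed.
HB.instance Definition _ f :=
  GRing.isLinear.Build rat fam (int -> V) *:%R (evf f) (evf_is_linear f).
Definition evfL f : {linear fam -> (int -> V)} := evf f.

Definition evm m f X : V := X m f.

Fact evm_is_linear m f : linear (evm m f).
Proof. by []. Qed.
HB.instance Definition _ m f :=
  GRing.isLinear.Build rat fam V *:%R (evm m f) (evm_is_linear m f).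
Definition evmL m f : {linear fam -> V} := evm m f.

Definition cst f : A := f mset0.

Fact cst_is_linear : linear cst.
Proof. by []. Qed.
HB.instance Definition _ := GRing.isLinear.Build rat V A *:%R cst cst_is_linear.
Definition cstL : {linear V -> A} := cst.
Definition currentL l : {linear V -> V} := current l.

(* A family is determined by its commutators with the currents, together with
   the constant terms of its action on constants. *)
Lemma family_unique (Y : pseq fam) :
  (forall k m, Y k m 0 = 0) ->
  (forall k m a, cst (Y k m (vac a)) = 0) ->
  (forall c d : nat, (c == 0%N) || (d == 0%N) -> forall a s,
     q ^+ d *: pseq_map (evfL (psum a s)) (pseq_map (adJ (c%:Z - d%:Z)) Y)
       = (q ^+ c - q ^+ d) *: pseq_map (evfL (psum a s)) Y) ->
  forall k m a s, Y k m (psum a s) = 0.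
Proof.
move=> Y0 Yvac YJ; elim/ltn_ind => k IHk m a s.
(* q^c - q^d has no constant term, so coefficient [k] of the right-hand side involves only
   coefficients of [Y] below [k]. *)
have coefR c d a' s' : ((q ^+ c - q ^+ d) *: pseq_map (evfL (psum a' s')) Y) k = 0.
  rewrite pscaleE big_nat_recl // coefB !coef0_q subrr scale0r add0r.
  rewrite big_nat_cond big1 // => i /andP[/andP[_ ik] _].
  apply/funext => m'; rewrite scalrfctE pseq_mapE /= /evf IHk ?scaler0 //.
  by lia.
elim: s m => [|n s IHs] m.
  (* Taking d = 0, the image of a constant is killed by every J_l with l > 0. *)
  apply: vac_unique; last exact: Yvac.
  move=> l l0; have [c el] : exists c : nat, l = c%:Z - 0%:Z by exists (absz l); lia.
  have := congr1 (fun z => z k (m + l)) (YJ c 0%N (orbT _) a [::]).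
  rewrite coefR expr0 scale1r !pseq_mapE /= /evf /comm -el addrK => /eqP.
  by rewrite (current_vac _ (ltW l0)) Y0 subr0 => /eqP.
have [->|n0] := posnP n; first by rewrite /= oppr0 current0 Y0.
(* With c = 0 and d = n, the bracket with J_{-n} vanishes at order [k], so J_{-n} can be pulled out
   of [Y]. *)
have /(congr1 (@^~ k)) := YJ 0%N n (isT : (0 == 0)%N || _) a s.
rewrite coefR pscaleE big_nat_recl // coef0_q scale1r subn0 big_nat_cond big1; last first.
  move=> i /andP[/andP[_ ik] _]; apply/funext => m'.
  rewrite scalrfctE !pseq_mapE /= /evf /comm sub0r.
  rewrite -[current (- n%:Z) (psum a s)]/(psum a (n :: s)) !IHk; try lia.
  by rewrite linear0 subrr scaler0.
move/(congr1 (@^~ (m - n%:Z))).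
rewrite addr0 !pseq_mapE /= /evf /comm sub0r opprK subrK IHs linear0 sub0r.
by move/eqP; rewrite oppr_eq0 => /eqP.
Qed.

Lemma Efam0 k m : E k m 0 = 0.
Proof. exact/graded0/graded_Qfam. Qed.

Definition pone a : pseq A := fun k => if k == 0%N then a else 0.

Lemma theta_pone a : theta (pone a) = 0.
Proof. by apply/funext => -[|k]; rewrite /theta /pone /= ?scaler0 ?scale0r addr0. Qed.

Lemma cst_nord X m a : graded X -> cst (nord X m (vac a)) = 0.
Proof.
move=> gX; rewrite /cst /nord /nord_upto series_sum big_nat_cond big1 // => n.
move=> /andP[/andP[n0 _] _]; rewrite seriesD current_vac ?graded0 //.
by rewrite addr0 current_mset0 //; lia.
Qed.

(** A normally ordered product has no constant term on constants, so only Q_0 = 1 survives; the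
    degree term of Q_1 vanishes because Q_0 sits in degree 0. *)
Lemma cst_Efam m a : pseq_map cstL (pseq_map (evmL m (vac a)) E)
  = if m == 0 then pone a else 0.
Proof.
have e0 k : cst (Qfam k.+1 m (vac a) : V) = 0.
  elim: k => [|k IHk].
    rewrite /= invr1 scale1r scale0r subr0 famD famN linearB /= cst_nord; last exact: graded_fone.
    have -> : fdeg (@fone A) m (vac a) = 0.
      by rewrite /fdeg /fone; case: eqP => [->|_]; rewrite ?scale0r ?scaler0.
    exact: subrr.
  rewrite -[Qfam k.+2]/(_ *: (nord (Qfam k.+1) - fdeg (Qfam k.+1) - _ *: Qfam k.+1)).
  have cN : cst (nord (@Qfam A k.+1) m (vac a)) = 0 by apply/cst_nord/graded_Qfam.
  move: cN IHk; rewrite famZ !famD !famN famZ /fdeg /cst !seriesE.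
  by move=> -> ->; rewrite !scaler0 !subrr scaler0.
apply/funext => -[|k]; rewrite !pseq_mapE /= /evm /Efam; last by rewrite e0; case: eqP.
by rewrite /= /fone; case: eqP => // _; rewrite /cst /vac eqxx.
Qed.
End Vacuum.

(** * Commutators with quadratic and cubic operators *)

Local Notation q := (1 + 'X : {poly rat}).

(** The left side is the constant term of (u/2) [:J^2:_n, E] on constants, with one factor q^j - 1
    per current; the right side is what the commutator formula predicts. It reduces to the geometric
    sum [geo]. *)
Lemma sum_expq_prod (n : nat) :
  (2^-1)%:P * 'X * \sum_(1 <= i < n) (q ^+ i - 1) * (q ^+ (n - i) - 1)
    = (q ^+ n - 1) * (-1 + ((n%:R - 1) / 2)%:P * 'X) + n%:R * 'X.
Proof.
case: n => [|n]; first by rewrite big_geq // mulr0 expr0 subrr mul0r add0r mul0r.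
have -> : \sum_(1 <= i < n.+1) (q ^+ i - 1) * (q ^+ (n.+1 - i) - 1)
    = n%:R * (q ^+ n.+1 + 1) - 2%:R * \sum_(1 <= i < n.+1) q ^+ i.
  transitivity (\sum_(1 <= i < n.+1) (q ^+ n.+1 + 1 - (q ^+ i + q ^+ (n.+1 - i)))).
    apply: eq_big_nat => i /andP[_ i_n].
    have -> : q ^+ n.+1 = q ^+ i * q ^+ (n.+1 - i) by rewrite -exprD subnKC // ltnW.
    by move: (q ^+ i) (q ^+ (_ - _)) => x y; ring.
  rewrite sumrB sumr_const_nat subn1 /=; congr (_ - _); first by rewrite mulr_natl.
  rewrite big_split /= mulr_natl mulr2n; congr (_ + _).
  rewrite big_nat_rev /=; apply: eq_big_nat => i /andP[i0 i_n].
  by congr (_ ^+ _); lia.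
have geo : 'X * \sum_(1 <= i < n.+1) q ^+ i = q ^+ n.+1 - q.
  have := subrX1 q n.+1; rewrite -(big_mkord xpredT (fun i => q ^+ i)) big_ltn // expr0.
  rewrite [q - 1]addrC addKr mulrDr mulr1 => e.
  by rewrite -[LHS](addKr 'X) -e; ring.
transitivity ((2^-1)%:P * ('X * (n%:R * (q ^+ n.+1 + 1)) - 2%:R * ('X * \sum_(1 <= i < n.+1) q ^+ i)) : {poly rat}).
  by ring.
rewrite geo; move: (q ^+ n.+1) => x.
have e2 : 2%:R * (2^-1)%:P = 1 :> {poly rat} by rewrite -polyC_natr -polyCM divff.
have -> : ((n.+1%:R - 1) / 2)%:P = n%:R * (2^-1)%:P :> {poly rat}.
  by rewrite -[n.+1%:R]natr1 addrK polyCM polyC_natr.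
move: ((2^-1)%:P) e2 => h e2; rewrite -[n.+1%:R]natr1.
transitivity (h * 'X * n%:R * (x + 1) - (2%:R * h) * (x - 1 - 'X)); first by ring.
rewrite e2.
transitivity ((x - 1) * (-1 + n%:R * h * 'X) + (2%:R * h) * (n%:R * 'X) + 'X); last by rewrite e2; ring.
by ring.
Qed.

Section Commutators.
Variable A : lmodType rat.
Local Notation V := (series A).
Local Notation fam := (fam A).
Implicit Types (f g : V) (mu nu : ipartition) (X Y : fam) (a : A).
Local Notation commJ l := (comm (@current A l) l).
Local Notation adJ l := (commL (@current A l) l).
Local Notation E := (@Efam A).
Local Notation HE := (pseq_map (fdegL A) E).

(** The Jacobi identity when [z, w] = c x. *)
Lemma comm_comm (z w : {linear V -> V}) k (x : {linear V -> V}) c l n X :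
  graded X ->
  (forall f, z (w f) - w (z f) = c *: x f) -> k = l + n ->
  comm z l (comm w n X) = comm w n (comm z l X) + c *: comm x k X.
Proof.
move=> gX zw ->; apply/funext => m; apply/funext => f; rewrite famD famZ /comm.
have -> : m - n - l = m - l - n by rewrite addrAC.
have -> : m - (l + n) = m - l - n by rewrite opprD addrA.
rewrite scalerBr -(gradedZ _ _ _ gX) -!zw (gradedB _ _ _ gX) !linearB /=.
have aux (U : zmodType) (t1 t2 t3 t4 t5 t6 : U) :
  t1 - t2 + (- t3 - - t4) = t5 - t3 + (- t2 - - t6) + (t1 - t5 + (- t6 - - t4)).
  by zmod.
exact: aux.
Qed.

(** :J^2:_n, which is twice the usual Virasoro mode. *)
Definition Lop n : V -> V := Jpow 2 n.
HB.instance Definition _ n := GRing.Linear.on (Lop n).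
Definition LopL n : {linear V -> V} := Lop n.

Lemma LopE B n f mu : (weight mu + absz n <= B)%N ->
  Lop n f mu = nord_upto B (@current A) n f mu.
Proof.
move=> leB; rewrite /Lop -[Jpow 2 n]/(nord (Jpow 1) n) Jpow1.
by apply: nord_uptoE => //; exact: graded_current.
Qed.

Lemma current_Lop l n f :
  current l (Lop n f) - Lop n (current l f) = (2%:R * l%:~R) *: current (l + n) f.
Proof.
have := congr1 (fun Z => Z (l + n) f) (commJ_Jpow A l 1).
have nE : l + n - l = n by rewrite addrC addKr.
by rewrite /comm Jpow1 famZ nE.
Qed.

Lemma Lop_vac n a : 0 <= n -> Lop n (vac a) = 0.
Proof.
move=> n0; apply/funext => mu; rewrite (LopE (B := (weight mu + absz n)%N)) //.
rewrite /nord_upto big_nat_cond big1 // => i /andP[/andP[i0 _] _].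
by rewrite !current_vac ?linear0 ?addr0 //; lia.
Qed.

Lemma Lop_negvac (p : nat) a :
  Lop (- p%:Z) (vac a) = \sum_(1 <= i < p) current (- i%:Z) (current (- (p - i)%N%:Z) (vac a)).
Proof.
apply/funext => mu; rewrite (LopE (B := (weight mu + p)%N)); last by rewrite abszN.
rewrite /nord_upto.
have [->|p0] := posnP p.
  rewrite [in RHS]big_geq // big_nat_cond big1 // => i /andP[/andP[i0 _] _].
  by rewrite !current_vac ?linear0 ?addr0 //; lia.
rewrite (big_cat_nat (n := p)) //=; last by rewrite ltnW // ltnS leq_addl.
rewrite seriesD [X in _ + X = _](_ : _ = 0) ?addr0.
  congr (_ mu); apply: eq_big_nat => i /andP[i0 ip].
  rewrite [current i _]current_vac // linear0 addr0; congr (current _ (current _ _)).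
  by lia.
rewrite big_nat_cond big1 // => i /andP[/andP[ip _] _].
by rewrite !current_vac ?linear0 ?addr0 //; lia.
Qed.

Lemma cst_Lop (p : nat) f :
  cst (Lop p%:Z f) = \sum_(1 <= i < p) cst (current (p - i)%N%:Z (current i%:Z f)).
Proof.
rewrite /cst (LopE (B := p)) ?weight0 // /nord_upto series_sum.
have [->|p0] := posnP p; first by rewrite !big_geq.
rewrite big_nat_recr //= seriesD subrr current0 current_mset0 ?addr0; last by lia.
apply: eq_big_nat => i /andP[i0 ip].
rewrite seriesD current_mset0 ?add0r; last by lia.
by congr (current _ _ _); lia.
Qed.

Lemma cst_Lop_neg (p : nat) f : cst (Lop (- p%:Z) f) = 0.
Proof.
rewrite /cst (LopE (B := p)) ?weight0 ?abszN // /nord_upto series_sum.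
rewrite big_nat_cond big1 // => i /andP[/andP[i0 _] _].
by rewrite seriesD !current_mset0 ?addr0 //; lia.
Qed.
End Commutators.

(** The linear algebra of [Ldefect_commJ], where x, y, z, w are q^a, q^b, q^c, q^d and u is 'X,
    abstracted so that [ring] sees independent scalars. The multipliers in the proof are those that
    eliminate [KC], [C'], [TC], [C] and [HC]. *)
Lemma Ldefect_key (M : lmodType {poly rat}) (x y z w u h l n n' : {poly rat})
    (TC TE KC KE C' HC HE C E : M) :
  2%:R * h = 1 ->
  y *: KC = (x - y) *: KE ->
  (y * w) *: C' = (x * z - y * w) *: E ->
  y *: TC = (x - y) *: TE + (l * x) *: E ->
  y *: C = (x - y) *: E ->
  y *: HC = (x - y) *: HE ->
  y *: ((w * u * h) *: (KC + (2%:R * l) *: C')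
        - (z - w) *: (u *: TC + n' *: C)
        + (u * w) *: (HC - l *: C - n *: C))
  = (x - y) *: ((w * u * h) *: KE - (z - w) *: (u *: TE + n' *: E)
        + (u * w) *: (HE - n *: E)).
Proof.
move=> h2 D1 D2 D3 D4 D5; apply/eqP; rewrite -subr_eq0; apply/eqP.
transitivity ((w * u * h) *: (y *: KC - (x - y) *: KE)
  + (l * u) *: ((y * w) *: C' - (x * z - y * w) *: E)
  + (- (z - w) * u) *: (y *: TC - ((x - y) *: TE + (l * x) *: E))
  + (- (z - w) * n' - u * w * (l + n)) *: (y *: C - (x - y) *: E)
  + (u * w) *: (y *: HC - (x - y) *: HE)); last first.
  by rewrite D1 D2 D3 D4 D5 !subrr !scaler0 !addr0.
have e : w * u * h * (2%:R * l) = w * u * l.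
  by transitivity (w * u * (2%:R * h) * l); [ring | rewrite h2 mulr1].
rewrite [(w * u * h) *: (KC + _)]scalerDr [(w * u * h) *: ((2%:R * l) *: C')]scalerA e.
lmod_start; lmod TC; lmod TE; lmod KC; lmod KE; lmod C'; lmod HC; lmod HE; lmod C; lmod E.
by rewrite eqxx.
Qed.

Section Commutators2.
Variable A : lmodType rat.
Local Notation V := (series A).
Local Notation fam := (fam A).
Implicit Types (f g : V) (mu nu : ipartition) (X Y : fam) (a : A).
Local Notation commJ l := (comm (@current A l) l).
Local Notation adJ l := (commL (@current A l) l).
Local Notation E := (@Efam A).
Local Notation HE := (pseq_map (fdegL A) E).

(** Differentiate [commJ_Efam] and subtract b times that identity. *)
Lemma theta_commJ_Efam (a b : nat) (l := a%:Z - b%:Z) :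
  q ^+ b *: theta (pseq_map (adJ l) E)
    = (q ^+ a - q ^+ b) *: theta E + ((l%:~R)%:P * q ^+ a) *: E.
Proof.
have D : q ^+ b *: pseq_map (adJ l) E = (q ^+ a - q ^+ b) *: E := commJ_Efam A a b.
set C := pseq_map (adJ l) E in D *; clearbody C.
have e : q ^+ b *: theta C + (b%:R * q ^+ b) *: C
    = (q ^+ a *: theta E + (a%:R * q ^+ a) *: E)
      - (q ^+ b *: theta E + (b%:R * q ^+ b) *: E).
  by rewrite -!theta_expq -thetaB -scalerBl D.
move/eqP: D; rewrite -subr_eq0 => /eqP D; move/eqP: e; rewrite -subr_eq0 => /eqP e.
apply/eqP; rewrite -subr_eq0; apply/eqP.
rewrite -[RHS](addr0 0) -{1}e -(scaler0 _ (- b%:R : {poly rat})) -{1}D /l.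
clear D e; move: (theta C) (theta E) (q ^+ a) (q ^+ b) => T1 T2 x y.
by lmod_start; lmod T1; lmod T2; lmod C; lmod (@Efam A); rewrite eqxx.
Qed.

Lemma current_Efam_vac (i : nat) m a :
  pseq_map (currentL A i%:Z) (pseq_map (evmL m (vac a)) E)
    = (q ^+ i - 1) *: pseq_map (evmL (m + i%:Z) (vac a)) E.
Proof.
have := congr1 (pseq_map (evmL (m + i%:Z) (vac a))) (commJ_Efam A i 0).
rewrite expr0 scale1r pseq_mapZ => <-; apply/funext => k.
rewrite !pseq_mapE /= /evm /comm subr0 addrK [current i (vac a)]current_vac //.
by rewrite Efam0 subr0.
Qed.

(** J_{-i} on the left leaves no constant term, so only one half of the bracket [J_{-i}, E] is
    seen. *)
Lemma cst_Efam_current (i : nat) m f :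
  q ^+ i *: pseq_map (cstL A) (pseq_map (evmL m (current (- i%:Z) f)) E)
    = (q ^+ i - 1) *: pseq_map (cstL A) (pseq_map (evmL (m - i%:Z) f) E).
Proof.
have := congr1 (fun s => pseq_map (cstL A) (pseq_map (evmL (m - i%:Z) f) s))
  (commJ_Efam A 0 i).
rewrite expr0 !pseq_mapZ => e.
rewrite -[q ^+ i - 1]opprB scaleNr -e -scalerN; congr (_ *: _).
apply/funext => k; rewrite pseqN !pseq_mapE /= /evm /comm sub0r opprK subrK.
have cB (g h : V) : cst (g - h) = cst g - cst h by [].
by rewrite cB {1}[cst (current _ _)]current_mset0 ?sub0r ?opprK //; lia.
Qed.

Local Notation CL n := (pseq_map (commL (LopL A n) n) E).

(** [Lop p] kills constants, so only its product with E on the right contributes, and each of its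
    two lowering currents yields a factor q^j - 1. *)
Lemma cst_commLop_pos (p : nat) m a :
  pseq_map (cstL A) (pseq_map (evmL m (vac a)) (CL p%:Z))
    = (\sum_(1 <= i < p) (q ^+ i - 1) * (q ^+ (p - i) - 1))
        *: pseq_map (cstL A) (pseq_map (evmL m (vac a)) E).
Proof.
rewrite scaler_suml.
transitivity (\sum_(1 <= i < p) pseq_map (cstL A) (pseq_map (currentL A (p - i)%N%:Z)
   (pseq_map (currentL A i%:Z) (pseq_map (evmL (m - p%:Z) (vac a)) E)))).
  apply/funext => k; rewrite pseq_sum !pseq_mapE /= /evm /comm.
  by rewrite Lop_vac // Efam0 subr0 cst_Lop.
apply: eq_big_nat => i /andP[i0 ip].
rewrite current_Efam_vac pseq_mapZ current_Efam_vac scalerA pseq_mapZ.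
have -> : m - p%:Z + i%:Z + (p - i)%N%:Z = m by lia.
by [].
Qed.

(** Dual case: [Lop (- p)] on the left leaves no constant term, so only the product with E on the
    left contributes. *)
Lemma cst_commLop_neg (p : nat) m a :
  q ^+ p *: pseq_map (cstL A) (pseq_map (evmL m (vac a)) (CL (- p%:Z)))
    = - (\sum_(1 <= i < p) (q ^+ i - 1) * (q ^+ (p - i) - 1))
        *: pseq_map (cstL A) (pseq_map (evmL m (vac a)) E).
Proof.
rewrite scaleNr scaler_suml.
transitivity (- \sum_(1 <= i < p) q ^+ p *: pseq_map (cstL A)
   (pseq_map (evmL (m + p%:Z) (current (- i%:Z) (current (- (p - i)%N%:Z) (vac a)))) E)).
  rewrite -scaler_sumr -scalerN; congr (_ *: _).
  apply/funext => k; rewrite pseqN pseq_sum !pseq_mapE /= /evm /comm opprK.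
  have cB (g h : V) : cst (g - h) = cst g - cst h by [].
  rewrite cB cst_Lop_neg sub0r; congr (- _).
  rewrite Lop_negvac graded_sum; last exact: graded_Qfam.
  by rewrite raddf_sum.
congr (- _); apply: eq_big_nat => i /andP[i0 ip].
have -> : q ^+ p = q ^+ (p - i) * q ^+ i by rewrite -exprD subnK // ltnW.
rewrite -scalerA cst_Efam_current !scalerA mulrC -scalerA cst_Efam_current scalerA.
have -> : m + p%:Z - i%:Z - (p - i)%N%:Z = m by lia.
by [].
Qed.

(* The error in the expected formula for the commutator of the Virasoro mode
   Lop n with Efam. Writing n = c - d with one of c, d zero clears the
   denominators of q ^ n. *)
Definition Ldefect (c d : nat) (n := c%:Z - d%:Z) : pseq fam :=
  (q ^+ d * 'X * (2^-1)%:P) *: CL n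
  - (q ^+ c - q ^+ d) *:
      ('X *: theta E + (-1 + 'X * ((n%:~R - 1) / 2)%:P) *: E)
  + ('X * q ^+ d) *: (HE - (n%:~R)%:P *: E).

Lemma map_Ldefect (M : lmodType rat) (F : {linear fam -> M}) (c d : nat)
    (n := c%:Z - d%:Z) :
  pseq_map F (Ldefect c d) =
  (q ^+ d * 'X * (2^-1)%:P) *: pseq_map F (CL n)
  - (q ^+ c - q ^+ d) *: ('X *: pseq_map F (theta E)
      + (-1 + 'X * ((n%:~R - 1) / 2)%:P) *: pseq_map F E)
  + ('X * q ^+ d) *: (pseq_map F HE - (n%:~R)%:P *: pseq_map F E).
Proof.
rewrite /Ldefect -/n; move: (CL n) (theta E) HE => s1 s2 s3; move: (@Efam A) => s4.
by rewrite pseq_mapD pseq_mapB !pseq_mapZ (pseq_mapD _ ('X *: s2)) (pseq_mapB _ s3) !pseq_mapZ.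
Qed.

(** By the Jacobi identity J_l passes into the commutator at the cost of 2 l [J_{l+n}, E]; this
    extra term cancels against those produced by theta E and deg E. *)
Lemma Ldefect_commJ (a b c d : nat) :
  q ^+ b *: pseq_map (adJ (a%:Z - b%:Z)) (Ldefect c d)
    = (q ^+ a - q ^+ b) *: Ldefect c d.
Proof.
set n := c%:Z - d%:Z; set l := a%:Z - b%:Z.
have JL : pseq_map (adJ l) (CL n) = pseq_map (commL (LopL A n) n) (pseq_map (adJ l) E)
   + (2%:R * l%:~R)%:P *: pseq_map (adJ (l + n)) E.
  apply/funext => k; rewrite pseqD pscaleC !pseq_mapE.
  apply: comm_comm => //; [exact: graded_Qfam | move=> f; exact: current_Lop].
have JH : pseq_map (adJ l) HE = pseq_map (fdegL A) (pseq_map (adJ l) E)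
     - (l%:~R)%:P *: pseq_map (adJ l) E.
  by apply/funext => k; rewrite pseqD pseqN pscaleC !pseq_mapE; exact: fdeg_comm.
have D4 : q ^+ b *: pseq_map (adJ l) E = (q ^+ a - q ^+ b) *: E := commJ_Efam A a b.
have D1 := congr1 (pseq_map (commL (LopL A n) n)) D4; rewrite !pseq_mapZ in D1.
have D5 := congr1 (pseq_map (fdegL A)) D4; rewrite !pseq_mapZ in D5.
have D3 : q ^+ b *: theta (pseq_map (adJ l) E)
    = (q ^+ a - q ^+ b) *: theta E + ((l%:~R)%:P * q ^+ a) *: E := theta_commJ_Efam a b.
have D2 : (q ^+ b * q ^+ d) *: pseq_map (adJ (l + n)) E
    = (q ^+ a * q ^+ c - q ^+ b * q ^+ d) *: E.
  rewrite -!exprD -commJ_Efam; congr (_ *: pseq_map _ _).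
  by have -> : l + n = (a + c)%N%:Z - (b + d)%N%:Z by rewrite /l /n; lia.
rewrite map_Ldefect /Ldefect -/n JL JH pseq_map_theta.
have h2 : 2%:R * (2^-1)%:P = 1 :> {poly rat} by rewrite -polyC_natr -polyCM divff.
rewrite polyCM polyC_natr; exact: Ldefect_key h2 D1 D2 D3 D4 D5.
Qed.
End Commutators2.

(** The linear algebra of [Ddefect_eq0], with v = u/2. The relation equal to 0 is the vanishing of
    [Ldefect], which eliminates the quadratic commutator [CL]. *)
Lemma Ddefect_key (M : lmodType {poly rat}) (x y u v l n' : {poly rat})
    (K CD CL TC TE HTC HTE HHC HHE HC HE C E : M) :
  u = 2%:R * v -> n' = -1 + v * (l - 1) ->
  y *: K = (x - y) *: CD ->
  (y * v) *: CL - (x - y) *: (u *: TE + n' *: E) + (u * y) *: (HE - l *: E) = 0 ->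
  y *: TC = (x - y) *: TE + (l * x) *: E ->
  y *: HTC = (x - y) *: HTE + (l * x) *: HE ->
  y *: C = (x - y) *: E ->
  y *: HC = (x - y) *: HE ->
  y *: HHC = (x - y) *: HHE ->
  y *: (u *: K + (l * v) *: CL + (u *: (HTC - l *: TC) - (HC - l *: C)
        + v *: (HHC - (2%:R * l) *: HC + (l * l) *: C - (HC - l *: C))))
  = (x - y) *: (u *: CD + (u *: HTE - HE + v *: (HHE - HE))).
Proof.
move=> -> -> D1 D2 D3 D4 D5 D6 D7; apply/eqP; rewrite -subr_eq0; apply/eqP.
transitivity ((2%:R * v) *: (y *: K - (x - y) *: CD)
  + l *: ((y * v) *: CL - (x - y) *: ((2%:R * v) *: TE + (-1 + v * (l - 1)) *: E)
          + (2%:R * v * y) *: (HE - l *: E))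
  + (- l * (2%:R * v)) *: (y *: TC - ((x - y) *: TE + (l * x) *: E))
  + (2%:R * v) *: (y *: HTC - ((x - y) *: HTE + (l * x) *: HE))
  + (l + v * (l * l + l)) *: (y *: C - (x - y) *: E)
  + (- 1 - v * (2%:R * l + 1)) *: (y *: HC - (x - y) *: HE)
  + v *: (y *: HHC - (x - y) *: HHE)); last first.
  by rewrite D1 D2 D3 D4 D5 D6 D7 !subrr !scaler0 !addr0.
lmod_start; lmod TC; lmod TE; lmod K; lmod CD; lmod CL; lmod HC; lmod HE; lmod C; lmod E.
by lmod HTC; lmod HTE; lmod HHC; lmod HHE; rewrite eqxx.
Qed.

Lemma half2 : 2%:R * (2^-1)%:P = 1 :> {poly rat}.
Proof. by rewrite -polyC_natr -polyCM divff. Qed.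

Lemma cst_Ldefect_pos (M : lmodType {poly rat}) (e : M) (n : nat) (S Q : {poly rat}) :
  (2^-1)%:P * 'X * S = (Q - 1) * (-1 + ((n%:R - 1) / 2)%:P * 'X) + n%:R * 'X ->
  ((2^-1)%:P * 'X) *: (S *: e)
    - (Q - 1) *: ((-1 + 'X * ((n%:~R - 1) / 2)%:P) *: e)
    + 'X *: (- ((n%:~R)%:P *: e)) = 0.
Proof.
move=> hS; rewrite scalerA hS pmulrn; by lmod_start; lmod e; rewrite oppr0 eqxx.
Qed.

Lemma cst_Ldefect_neg (M : lmodType {poly rat}) (e : M) (n : nat) (S Q : {poly rat}) :
  (2^-1)%:P * 'X * S = (Q - 1) * (-1 + ((n%:R - 1) / 2)%:P * 'X) + n%:R * 'X ->
  ((2^-1)%:P * 'X) *: (- S *: e)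
    - (1 - Q) *: ((-1 + 'X * (((- n%:Z)%:~R - 1) / 2)%:P) *: e)
    + ('X * Q) *: (- (((- n%:Z)%:~R)%:P *: e)) = 0.
Proof.
move=> hS; rewrite scalerA mulrN hS.
have -> : ((n%:R - 1) / 2)%:P = (n%:R - 1) * (2^-1)%:P :> {poly rat}.
  by rewrite polyCM polyCB polyC_natr polyC1.
have -> : (((- n%:Z)%:~R - 1) / 2)%:P = (- n%:R - 1) * (2^-1)%:P :> {poly rat}.
  by rewrite polyCM polyCB mulrNz polyCN -pmulrn polyC_natr polyC1.
have -> : ((- n%:Z)%:~R)%:P = - n%:R :> {poly rat}.
  by rewrite mulrNz polyCN -pmulrn polyC_natr.
have : 'X = 2%:R * ((2^-1)%:P * 'X) :> {poly rat} by rewrite mulrA half2 mul1r.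
move: ((2^-1)%:P) => h; move: ('X) => u; move: {-2}(h * u) (erefl (h * u)) => v vE uE.
have -> : (n%:R - 1) * h * u = (n%:R - 1) * v by rewrite vE mulrA.
have -> : u * ((- n%:R - 1) * h) = (- n%:R - 1) * v by rewrite vE; ring.
rewrite uE.
by lmod_start; lmod e; rewrite oppr0 eqxx.
Qed.

Section Commutators3.
Variable A : lmodType rat.
Local Notation V := (series A).
Local Notation fam := (fam A).
Implicit Types (f g : V) (mu nu : ipartition) (X Y : fam) (a : A).
Local Notation commJ l := (comm (@current A l) l).
Local Notation adJ l := (commL (@current A l) l).
Local Notation E := (@Efam A).
Local Notation HE := (pseq_map (fdegL A) E).
Local Notation CL n := (pseq_map (commL (LopL A n) n) E).

Lemma evm_fdeg m f (s : pseq fam) :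
  pseq_map (evmL m f) (pseq_map (fdegL A) s) = (m%:~R)%:P *: pseq_map (evmL m f) s.
Proof. by apply/funext => k; rewrite pscaleC. Qed.

Lemma evm0_comm (z : {linear V -> V}) n m :
  pseq_map (evmL m 0) (pseq_map (commL z n) E) = 0.
Proof.
apply/funext => k; rewrite !pseq_mapE /= /evm /comm linear0 !Efam0.
by rewrite linear0 subrr.
Qed.

Lemma evm0_Efam m : pseq_map (evmL m 0) E = 0.
Proof. by apply/funext => k; rewrite pseq_mapE /= /evm Efam0. Qed.

Lemma theta0 (M : lmodType rat) : theta (0 : pseq M) = 0.
Proof. exact: raddf0. Qed.

Lemma deg_cst_Efam m a :
  (m%:~R)%:P *: pseq_map (cstL A) (pseq_map (evmL m (vac a)) E) = 0.
Proof. by rewrite cst_Efam; case: eqP => [->|_]; rewrite ?scaler0 // scale0r. Qed.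

Lemma theta_cst_Efam m a :
  theta (pseq_map (cstL A) (pseq_map (evmL m (vac a)) E)) = 0.
Proof. by rewrite cst_Efam; case: eqP => _; rewrite ?theta_pone ?theta0. Qed.

Lemma map_Ldefect2 (M M' : lmodType rat) (G : {linear M -> M'}) (F : {linear fam -> M})
    (c d : nat) (n := c%:Z - d%:Z) :
  pseq_map G (pseq_map F (@Ldefect A c d)) =
  (q ^+ d * 'X * (2^-1)%:P) *: pseq_map G (pseq_map F (CL n))
  - (q ^+ c - q ^+ d) *: ('X *: pseq_map G (pseq_map F (theta E))
      + (-1 + 'X * ((n%:~R - 1) / 2)%:P) *: pseq_map G (pseq_map F E))
  + ('X * q ^+ d) *: (pseq_map G (pseq_map F HE) - (n%:~R)%:P *: pseq_map G (pseq_map F E)).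
Proof. exact: (map_Ldefect (G \o F : {linear fam -> M'}) c d). Qed.

(** Brackets come from [Ldefect_commJ], constant terms from [sum_expq_prod]. With c or d zero, n = c
    - d still takes every integer value, and the constant terms fall under one of the two computed
    cases. *)
Lemma Ldefect_eq0 (c d : nat) : (c == 0%N) || (d == 0%N) ->
  forall k m a s, @Ldefect A c d k m (psum a s) = 0.
Proof.
move=> cd; apply: family_unique; last first.
- move=> c' d' _ a s.
  by have := congr1 (pseq_map (evfL (psum a s))) (Ldefect_commJ A c' d' c d); rewrite !pseq_mapZ.
- move=> k m a.
  suff /(congr1 (@^~ k)) : pseq_map (cstL A) (pseq_map (evmL m (vac a)) (@Ldefect A c d)) = 0.
    by [].
  rewrite map_Ldefect2 !pseq_map_theta theta_cst_Efam evm_fdeg pseq_mapZ deg_cst_Efam.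
  rewrite scaler0 add0r sub0r.
  case/orP: cd => /eqP->; rewrite ?subr0 ?sub0r expr0.
    have -> : q ^+ d * 'X * (2^-1)%:P = (2^-1)%:P * 'X * q ^+ d :> {poly rat} by ring.
    rewrite -[((2^-1)%:P * 'X * q ^+ d) *: _]scalerA cst_commLop_neg.
    exact: cst_Ldefect_neg (sum_expq_prod d).
  have -> : 1 * 'X * (2^-1)%:P = (2^-1)%:P * 'X :> {poly rat} by ring.
  rewrite mulr1 cst_commLop_pos; exact: cst_Ldefect_pos (sum_expq_prod c).
- move=> k m.
  suff /(congr1 (@^~ k)) : pseq_map (evmL m 0) (@Ldefect A c d) = 0 by [].
  rewrite map_Ldefect pseq_map_theta evm_fdeg.
  by rewrite evm0_comm evm0_Efam theta0 !(scaler0, addr0, oppr0).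
Qed.

(* This is the cut-and-join operator, as the zero mode of :J^3: / 6. *)
Definition cutjoin f : V := 6%:R^-1 *: Jpow 3 0 f.

Fact cutjoin_is_linear : linear cutjoin.
Proof. by move=> c f g; rewrite /cutjoin linearP /= scalerDr !scalerA mulrC. Qed.
HB.instance Definition _ :=
  GRing.isLinear.Build rat V V *:%R cutjoin cutjoin_is_linear.

Lemma current_cutjoin l f :
  current l (cutjoin f) - cutjoin (current l f) = (l%:~R / 2%:R) *: Lop l f.
Proof.
have := congr1 (fun Z : fam => Z l f) (commJ_Jpow A l 2).
rewrite /comm famZ subrr => e; rewrite /cutjoin linearZ /= -scalerBr e scalerA.
by congr (_ *: _); field.
Qed.

Lemma cutjoin_vac a : cutjoin (vac a) = 0.
Proof.
suff e : Jpow 3 0 (vac a) = 0 by rewrite /cutjoin e scaler0.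
apply/funext => mu; rewrite -[Jpow 3 0]/(nord (@Lop A) 0) /nord /nord_upto.
rewrite big_nat_cond big1 // => n /andP[/andP[n0 _] _].
by rewrite add0r Lop_vac // current_vac // !linear0 addr0.
Qed.

Lemma cst_cutjoin f : cst (cutjoin f) = 0.
Proof.
suff e : Jpow 3 0 f mset0 = 0 by rewrite /cst /cutjoin seriesZ e scaler0.
by rewrite -[Jpow 3 0]/(nord (@Lop A) 0) /nord /nord_upto weight0 big_geq.
Qed.

Local Notation CD := (pseq_map (commL cutjoin 0) E).
Local Notation h := ((2^-1)%:P : {poly rat}).

(* The error in the expected formula for the commutator of cutjoin with Efam. *)
Definition Ddefect : pseq fam :=
  'X *: CD + ('X *: pseq_map (fdegL A) (theta E) - HE
              + ('X * h) *: (pseq_map (fdegL A) HE - HE)).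

Lemma map_Ddefect (M : lmodType rat) (F : {linear fam -> M}) :
  pseq_map F Ddefect = 'X *: pseq_map F CD
    + ('X *: pseq_map F (pseq_map (fdegL A) (theta E)) - pseq_map F HE
       + ('X * h) *: (pseq_map F (pseq_map (fdegL A) HE) - pseq_map F HE)).
Proof.
rewrite /Ddefect; move: CD (pseq_map _ (theta E)) (pseq_map _ HE) => s1 s2 s3.
move: HE => s4; rewrite pseq_mapD (pseq_mapD _ (_ - s4)) (pseq_mapB _ _ s4) !pseq_mapZ.
by rewrite (pseq_mapB _ s3).
Qed.

(** The bracket of J_l with [D, E] produces (l/2) [[Lop l], E], which [Ldefect_eq0] rewrites through
    theta E, deg E and E. As that is known on polynomials, the brackets are compared after
    evaluation at [psum a s]. Constant terms vanish because D kills constants and never produces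
    one. *)
Lemma Ddefect_eq0 k m a s : Ddefect k m (psum a s) = 0.
Proof.
apply: family_unique k m a s => [k m|k m a|c d cd a s].
- suff /(congr1 (@^~ k)) : pseq_map (evmL m 0) Ddefect = 0 by [].
  rewrite map_Ddefect !evm_fdeg pseq_map_theta.
  by rewrite evm0_comm evm0_Efam theta0 !(scaler0, addr0, oppr0).
- suff /(congr1 (@^~ k)) : pseq_map (cstL A) (pseq_map (evmL m (vac a)) Ddefect) = 0.
    by [].
  have -> : pseq_map (cstL A) (pseq_map (evmL m (vac a)) Ddefect)
      = pseq_map (cstL A \o evmL m (vac a) : {linear fam -> A}) Ddefect by [].
  rewrite map_Ddefect.
  have F1 (s : pseq fam) : pseq_map (cstL A \o evmL m (vac a) : {linear fam -> A}) s
    = pseq_map (cstL A) (pseq_map (evmL m (vac a)) s) by [].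
  rewrite !F1 !evm_fdeg !pseq_mapZ !pseq_map_theta theta_cst_Efam.
  have -> : pseq_map (cstL A) (pseq_map (evmL m (vac a)) CD) = 0.
    apply/funext => k'; rewrite !pseq_mapE /= /evm /comm cutjoin_vac Efam0 subr0.
    exact: cst_cutjoin.
  by rewrite deg_cst_Efam !(scaler0, addr0, oppr0).
set l := c%:Z - d%:Z.
set f := psum a s; set C := pseq_map (adJ l) E.
have JH (Z : pseq fam) : pseq_map (adJ l) (pseq_map (fdegL A) Z)
   = pseq_map (fdegL A) (pseq_map (adJ l) Z) - (l%:~R)%:P *: pseq_map (adJ l) Z.
  by apply/funext => k; rewrite pseqD pseqN pscaleC !pseq_mapE; exact: fdeg_comm.
have JD : pseq_map (adJ l) CD = pseq_map (commL cutjoin 0) C + (l%:~R / 2)%:P *: CL l.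
  apply/funext => k; rewrite pseqD pscaleC !pseq_mapE.
  apply: comm_comm => //; [exact: graded_Qfam | move=> g; exact: current_cutjoin | by rewrite addr0].
have D4 : q ^+ d *: C = (q ^+ c - q ^+ d) *: E := commJ_Efam A c d.
have D3 : q ^+ d *: theta C
    = (q ^+ c - q ^+ d) *: theta E + ((l%:~R)%:P * q ^+ c) *: E := theta_commJ_Efam A c d.
have D1 : q ^+ d *: pseq_map (commL cutjoin 0) C = (q ^+ c - q ^+ d) *: CD.
  by have := congr1 (pseq_map (commL cutjoin 0)) D4; rewrite !pseq_mapZ.
have D5 : q ^+ d *: pseq_map (fdegL A) C = (q ^+ c - q ^+ d) *: HE.
  by have := congr1 (pseq_map (fdegL A)) D4; rewrite !pseq_mapZ.
have D6 : q ^+ d *: pseq_map (fdegL A) (pseq_map (fdegL A) C)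
    = (q ^+ c - q ^+ d) *: pseq_map (fdegL A) HE.
  by have := congr1 (pseq_map (fdegL A)) D5; rewrite !pseq_mapZ.
have D7 : q ^+ d *: pseq_map (fdegL A) (theta C)
    = (q ^+ c - q ^+ d) *: pseq_map (fdegL A) (theta E) + ((l%:~R)%:P * q ^+ c) *: HE.
  by have := congr1 (pseq_map (fdegL A)) D3; rewrite pseq_mapD !pseq_mapZ.
have D2 : pseq_map (evfL f) (@Ldefect A c d) = 0.
  by apply/funext => k; apply/funext => m; exact: Ldefect_eq0.
have JHH : pseq_map (adJ l) (pseq_map (fdegL A) HE)
    = pseq_map (fdegL A) (pseq_map (fdegL A) C)
      - (2%:R * (l%:~R)%:P) *: pseq_map (fdegL A) C + ((l%:~R)%:P * (l%:~R)%:P) *: C.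
  rewrite JH JH -/C pseq_mapB pseq_mapZ.
  have aux (U : lmodType {poly rat}) (r : {poly rat}) (s1 s2 s3 : U) :
      s1 - r *: s2 - r *: (s2 - r *: s3) = s1 - (2%:R * r) *: s2 + (r * r) *: s3.
    by rewrite -[s1]scale1r; lmod_start; lmod s1; lmod s2; lmod s3; rewrite eqxx.
  exact: aux.
have JY : pseq_map (adJ l) Ddefect =
    'X *: pseq_map (commL cutjoin 0) C + ((l%:~R)%:P * ('X * h)) *: CL l
    + ('X *: (pseq_map (fdegL A) (theta C) - (l%:~R)%:P *: theta C)
       - (pseq_map (fdegL A) C - (l%:~R)%:P *: C)
       + ('X * h) *: (pseq_map (fdegL A) (pseq_map (fdegL A) C)
          - (2%:R * (l%:~R)%:P) *: pseq_map (fdegL A) C + ((l%:~R)%:P * (l%:~R)%:P) *: C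
          - (pseq_map (fdegL A) C - (l%:~R)%:P *: C))).
  have tC : pseq_map (adJ l) (theta E) = theta C := pseq_map_theta _ _.
  rewrite map_Ddefect JD JHH !JH tC -/C; congr (_ + _).
  by rewrite scalerDr scalerA polyCM mulrCA.
have mapY (U W : lmodType {poly rat}) (F : {linear U -> W}) (u v l1 l2 l3 l4 : {poly rat})
    (s1 s2 s3 s4 s5 s6 s7 : U) :
  F (u *: s1 + l1 *: s2 + (u *: (s3 - l2 *: s4) - (s5 - l2 *: s6)
      + v *: (s7 - l3 *: s5 + l4 *: s6 - (s5 - l2 *: s6))))
  = u *: F s1 + l1 *: F s2 + (u *: (F s3 - l2 *: F s4) - (F s5 - l2 *: F s6)
      + v *: (F s7 - l3 *: F s5 + l4 *: F s6 - (F s5 - l2 *: F s6))).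
  have FD x y : F (x + y) = F x + F y by exact: linearD.
  have FN x : F (- x) = - F x by exact: linearN.
  have FZ r x : F (r *: x) = r *: F x by exact: linearZ.
  by rewrite !(FD, FN, FZ).
have map2 p1 p2 p3 (s1 s2 s3 : pseq fam) : p1 *: s1 = p2 *: s2 + p3 *: s3 ->
  p1 *: pseq_map (evfL f) s1 = p2 *: pseq_map (evfL f) s2 + p3 *: pseq_map (evfL f) s3.
  by move/(congr1 (pseq_map (evfL f))); rewrite pseq_mapD !pseq_mapZ.
rewrite JY map_Ddefect mapY.
apply: (Ddefect_key (n' := -1 + 'X * ((l%:~R - 1) / 2)%:P)).
- by rewrite mulrCA half2 mulr1.
- by rewrite polyCM polyCB polyC1 mulrA mulrAC.
- by have := congr1 (pseq_map (evfL f)) D1; rewrite !pseq_mapZ.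
- by rewrite -D2 map_Ldefect -/l mulrA.
- exact: map2 D3.
- exact: map2 D7.
- by have := congr1 (pseq_map (evfL f)) D4; rewrite !pseq_mapZ.
- by have := congr1 (pseq_map (evfL f)) D5; rewrite !pseq_mapZ.
- by have := congr1 (pseq_map (evfL f)) D6; rewrite !pseq_mapZ.
Qed.

End Commutators3.

(** * The cut-and-join operator *)

Section CutJoin.
Variable A : lmodType rat.
Implicit Types (f g : series A) (a : A).

(** The coefficient of u^(k+1) of [Ddefect] in degree m = -1, where m (m - 1) / 2 = 1. *)
Lemma comm_cutjoin_Qfam k a s : let f := psum a s in
  cutjoin (Qfam k (-1) f) - Qfam k (-1) (cutjoin f)
    = k%:R *: Qfam k.+1 (-1) f + (k%:R - 1) *: Qfam k (-1) f.
Proof.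
move=> f.
have : pseq_map (evmL (-1) f) (@Ddefect A) k.+1 = 0 := Ddefect_eq0 k.+1 (-1) a s.
rewrite map_Ddefect !evm_fdeg pseq_map_theta.
set e := pseq_map (evmL _ _) (@Efam A); set eD := pseq_map _ (pseq_map _ _).
have eE i : e i = Qfam i (-1) f by [].
have eDE : eD k = cutjoin (Qfam k (-1) f) - Qfam k (-1) (cutjoin f).
  by rewrite /eD !pseq_mapE /= /evm /comm subr0.
rewrite -eDE -!eE; clearbody e eD; clear eE eDE.
rewrite -(scalerA 'X) !(pseqD, pseqN) !pscaleX !pscaleC !(pseqD, pseqN) !pscaleC.
rewrite /theta => /eqP; rewrite addr_eq0 => /eqP->.
move: (e k) (e k.+1) => x y; rewrite -[k.+1%:R]natr1 !scaleN1r.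
rewrite !opprK -[x]scale1r -[y]scale1r.
lmod_start; lmod y; lmod x; first by rewrite eqxx.
by field.
Qed.
Lemma cutjoin_current (n : nat) f :
  cutjoin (current (- n%:Z) f)
    = current (- n%:Z) (cutjoin f) + (n%:R / 2) *: Lop (- n%:Z) f.
Proof.
have := current_cutjoin (- n%:Z) f => /eqP; rewrite subr_eq => /eqP->.
by rewrite mulrNz mulNr scaleNr -pmulrn addrAC addNr add0r.
Qed.

Lemma Lop_current (n m : nat) f :
  Lop (- n%:Z) (current (- m%:Z) f)
    = current (- m%:Z) (Lop (- n%:Z) f) + (2 * m%:R) *: current (- (n + m)%N%:Z) f.
Proof.
have := current_Lop (- m%:Z) (- n%:Z) f => /eqP; rewrite subr_eq => /eqP->.
have -> : - m%:Z - n%:Z = - (n + m)%N%:Z by lia.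
by rewrite mulrNz mulrN scaleNr -pmulrn addrAC addNr add0r.
Qed.

Lemma psumZ c a s : psum (c *: a) s = c *: psum a s.
Proof.
elim: s => /= [|n s ->]; last by rewrite linearZ.
by apply/funext => mu; rewrite seriesZ /vac; case: eqP; rewrite ?scaler0.
Qed.

Lemma psumD a b s : psum (a + b) s = psum a s + psum b s.
Proof.
elim: s => /= [|n s ->]; last by rewrite linearD.
by apply/funext => mu; rewrite seriesD /vac; case: eqP; rewrite ?addr0.
Qed.

Lemma psum_swap a n m s : psum a (n :: m :: s) = psum a (m :: n :: s).
Proof.
rewrite /=; apply/eqP; rewrite -subr_eq0 currentC.
case: ifP => // /eqP nm0; have -> : n = 0%N by lia.
by rewrite oppr0 scale0r.
Qed.

Lemma psum_swap3 a n i j s : psum a (n :: i :: j :: s) = psum a (i :: j :: n :: s).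
Proof.
rewrite psum_swap; exact: (congr1 (current (- i%:Z)) (psum_swap a n j s)).
Qed.

Lemma psum_cat_cons a s n t : psum a (s ++ n :: t) = psum a (n :: s ++ t).
Proof.
elim: s => //= m s IHs; rewrite IHs; exact: (psum_swap a m n (s ++ t)).
Qed.

Lemma psum_perm a s t : perm_eq s t -> psum a s = psum a t.
Proof.
elim: s t => [|n s IHs] t; first by rewrite perm_sym => /perm_nilP->.
move=> st; have nt : n \in t by rewrite -(perm_mem st) mem_head.
case/splitPr: nt st => t1 t2; rewrite perm_sym -cat1s perm_catCA cat1s perm_cons perm_sym.
by move=> /IHs e; rewrite psum_cat_cons /= e.
Qed.

Section Lists.
Variables (T : eqType) (w : T -> nat).
Implicit Type r : seq T.

(** On constants [Lop (- n)] splits n in two, and its bracket with p_m is 2 m p_(n+m). The parts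
    carry distinct labels, so that equal parts can be removed individually; the labels will be
    cycles or positions. *)
Lemma Lop_psum n a r : uniq r ->
  Lop (- n%:Z) (psum a (map w r))
    = \sum_(1 <= i < n) psum a (i :: (n - i)%N :: map w r)
      + \sum_(Y <- r) (2 * (w Y)%:R) *: psum a ((n + w Y)%N :: map w (rem Y r)).
Proof.
elim: r => [|Z r IHr] /=; first by rewrite big_nil addr0 Lop_negvac.
case/andP=> Zr ur; rewrite Lop_current IHr // linearD /= !linear_sum /=.
rewrite big_cons eqxx -addrA; congr (_ + _).
  apply: eq_bigr => i _.
  exact: (psum_swap3 a (w Z) i (n - i) (map w r)).
rewrite addrC; congr (_ + _); rewrite !big_seq; apply: eq_bigr => Y Yr.
rewrite linearZ /=; congr (_ *: _).
have -> : (Z == Y) = false by apply: contraNF Zr => /eqP->.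
exact: (psum_swap a (w Z) (n + w Y) (map w (rem Y r))).
Qed.

(** Induction on the factors through [D, J_{-n}] = (n/2) [Lop (- n)]. The factor 2 in the join terms
    of [Lop] accounts for the two orders of a pair of parts. *)
Lemma cutjoin_psum a r : uniq r ->
  cutjoin (psum a (map w r)) = 2^-1 *: \sum_(X <- r) (w X)%:R *:
    (\sum_(1 <= i < w X) psum a (i :: (w X - i)%N :: map w (rem X r))
     + \sum_(Y <- rem X r) (w Y)%:R *: psum a ((w X + w Y)%N :: map w (rem Y (rem X r)))).
Proof.
elim: r => [|Z r IHr] /=; first by rewrite big_nil scaler0 cutjoin_vac.
case/andP=> Zr ur; rewrite cutjoin_current IHr // Lop_psum // linearZ /= linear_sum /=.
rewrite big_cons eqxx mulrC -scalerA -scalerDr; congr (_ *: _).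
have ZY Y : Y \in r -> (Z == Y) = false by move=> Yr; apply: contraNF Zr => /eqP->.
have -> : \sum_(j <- r) (w j)%:R *:
   (\sum_(1 <= i < w j) psum a [:: i, (w j - i)%N & map w (if Z == j then r else Z :: rem j r)] +
    \sum_(Y <- if Z == j then r else Z :: rem j r)
       (w Y)%:R *: psum a ((w j + w Y)%N :: map w (rem Y (if Z == j then r else Z :: rem j r))))
  = \sum_(j <- r) current (- (w Z)%:Z) ((w j)%:R *:
    (\sum_(1 <= i < w j) psum a (i :: (w j - i)%N :: map w (rem j r))
     + \sum_(Y <- rem j r) (w Y)%:R *: psum a ((w j + w Y)%N :: map w (rem Y (rem j r)))))
   + \sum_(j <- r) ((w j)%:R * (w Z)%:R) *: psum a ((w Z + w j)%N :: map w (rem j r)).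
  rewrite -big_split /= !big_seq; apply: eq_bigr => j jr; rewrite ZY // linearZ /= -scalerA -scalerDr.
  congr (_ *: _); rewrite big_cons /= eqxx addnC linearD /= -addrA; congr (_ + _).
    rewrite linear_sum /=; apply: eq_bigr => i _.
    exact: (esym (psum_swap3 a (w Z) i (w j - i) (map w (rem j r)))).
  rewrite addrC linear_sum /=; congr (_ + _); rewrite !big_seq; apply: eq_bigr => Y Yr.
  rewrite linearZ /=; congr (_ *: _).
  have -> : (Z == Y) = false by apply: ZY; apply: mem_rem Yr.
  exact: (psum_swap a (w j + w Y) (w Z) _).
rewrite [RHS]addrCA; congr (_ + _); rewrite !scalerDr -addrA; congr (_ + _).
rewrite !scaler_sumr -big_split /=; apply: eq_bigr => Y _.
by rewrite !scalerA -scalerDl; congr (_ *: _); ring.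
Qed.
End Lists.
End CutJoin.

(** * Words *)

Definition posnats (B : nat) : seq posnat := pmap insub (iota 1 B).

Lemma mem_posnats B (p : posnat) : (p \in posnats B) = (val p <= B)%N.
Proof.
rewrite /posnats mem_pmap_sub mem_iota add1n ltnS.
by have -> : (0 < val p)%N by exact: valP p.
Qed.

Lemma posnats_uniq B : uniq (posnats B).
Proof. exact/pmap_sub_uniq/iota_uniq. Qed.

Lemma sum_posnats (M : nmodType) B (F : nat -> M) :
  \sum_(p <- posnats B) F (val p) = \sum_(1 <= n < B.+1) F n.
Proof.
rewrite /index_iota subn1 -(big_map val xpredT F) /posnats.
have -> : map val (pmap insub (iota 1 B) : seq posnat) = iota 1 B.
  rewrite pmap_filter; last exact: insubK.
  by apply/all_filterP/allP => n; rewrite mem_iota => /andP[n0 _]; rewrite isSome_insub.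
by [].
Qed.

Definition letters (B : nat) : seq letter :=
  [seq inl p | p <- posnats B] ++ [seq inr p | p <- posnats B].

Lemma mem_letters B l : (l \in letters B) = (absz (ldeg l) <= B)%N.
Proof.
rewrite mem_cat; case: l => p /=; rewrite ?abszN /=.
  rewrite mem_map ?mem_posnats; last by move=> x y [].
  by rewrite orbC (_ : _ \in _ = false) //; apply/negP => /mapP[].
rewrite [X in _ || X]mem_map ?mem_posnats; last by move=> x y [].
by rewrite (_ : _ \in _ = false) //; apply/negP => /mapP[].
Qed.

Lemma letters_uniq B : uniq (letters B).
Proof.
rewrite cat_uniq !map_inj_uniq ?posnats_uniq /=; [|by move=> x y []|by move=> x y []].
by rewrite andbT; apply/hasP => -[l /mapP[p _ ->] /mapP[]].
Qed.

Fixpoint words (B k : nat) : seq word :=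
  [::] :: (if k is k'.+1 then [seq l :: w | l <- letters B, w <- words B k'] else [::]).

Lemma mem_words B k w :
  (w \in words B k) = (size w <= k)%N && all (mem (letters B)) w.
Proof.
elim: k w => [|k IHk] [|l w] /=; rewrite ?inE //=.
rewrite ltnS; apply/allpairsP/and3P => /=.
  case=> -[l' w'] /= [ll' ww' [-> ->]]; move: ww'; rewrite IHk => /andP[-> ->].
  by rewrite ll'.
by case=> sw lB wB; exists (l, w); rewrite /= IHk sw wB.
Qed.

Lemma words_uniq B k : uniq (words B k).
Proof.
elim: k => //= k IHk; apply/andP; split; first by apply/allpairsP => -[p [_ _]].
by apply: allpairs_uniq; rewrite ?letters_uniq // => -[l w] [l' w'] _ _ [-> ->].
Qed.

Definition Jcoef (l : letter) : rat := if l is inl n then (val n)%:R else 1.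

Lemma JfieldE x l : Jfield x [:: l] = if x == ldeg l - 1 then Jcoef l else 0.
Proof. by case: l. Qed.

(** J consists of one-letter words, so only the cut after the first letter contributes, and only at
    the power of z attached to that letter. *)
Lemma mulF_Jfield F x l w :
  mulF Jfield F x (l :: w) = Jcoef l * F (x - ldeg l + 1) w.
Proof.
have main : \sum_(y \in [set: int]%classic) Jfield y [:: l] * F (x - y) w
    = Jcoef l * F (x - ldeg l + 1) w.
  rewrite (fsbigE [:: ldeg l - 1]) // => [|y _].
    rewrite big_mkcond big_seq1 ifT ?inE // JfieldE eqxx.
    by congr (_ * F _ _); rewrite opprB addrA addrAC.
  by rewrite inE JfieldE => /negPf->; rewrite mul0r.
pose i1 := @Ordinal (size (l :: w)).+1 1 isT.
rewrite /mulF (bigD1 i1) //= [X in _ + X]big1 ?addr0; last first.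
  move=> i i_ne1; apply: fsbig1 => y _.
  suff -> : Jfield y (take i (l :: w)) = 0 by rewrite mul0r.
  apply/eqP; apply: contraNT i_ne1 => /Jfield_deg[l' e _]; apply/eqP/val_inj => /=.
  have := congr1 size e; rewrite size_take_min /= => <-.
  by apply/esym/minn_idPl; rewrite -ltnS; exact: ltn_ord i.
by rewrite take0 drop0; exact: main.
Qed.

Lemma mulF_Jfield_nil F x : mulF Jfield F x [::] = 0.
Proof. by rewrite /mulF big_ord_recl big_ord0 fsbig1 ?addr0 // => y _; rewrite mul0r. Qed.

Section Words.
Variable A : lmodType rat.
Local Notation V := (series A).
Implicit Types (f g : V) (mu nu : ipartition).

Definition word_term k m f mu w : A :=
  Pfield k (- m - k%:Z) w *: act_word (normal_order w) f mu.

(** The letters t_n of a contributing word have total index at most [weight mu], and the degree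
    fixes the difference with the total index of the derivatives. The explicit bound makes [Pop] a
    sum over a list. *)
Lemma word_term_support k m f mu w (B : nat) : (0 < k)%N ->
  (weight mu <= B)%N -> (weight mu)%:Z + m <= B%:Z ->
  word_term k m f mu w != 0 -> w \in words B k.
Proof.
move=> k0 muB mumB; rewrite /word_term scaler_eq0 negb_or.
move=> /andP[/(Pfield_deg k0)[sw]]; rewrite subrK => degw nz.
rewrite mem_words sw /=; apply/allP => l lw; rewrite /= mem_letters.
pose T := (\sum_(l <- w | is_t l) absz (ldeg l))%N.
pose D := (\sum_(l <- w | ~~ is_t l) absz (ldeg l))%N.
have TD : T%:Z - D%:Z = - m.
  rewrite -degw (bigID is_t) /= /T /D !(big_morph Posz PoszD (erefl _)) -sumrN.
  by congr (_ + _); apply: eq_bigr => -[n|n] //=; rewrite abszN.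
have leT : (T <= weight mu)%N.
  have [ts wts] : exists ts, filter is_t w = [seq inl n | n <- ts].
    elim: (w) => [|[n|n] w' [ts e]] /=; first by exists [::].
    - by exists (n :: ts); rewrite e.
    - by exists ts.
  move: nz; rewrite /normal_order /act_word foldr_cat wts => /mul_t_weight le.
  by rewrite /T -big_filter wts big_map.
have le_l (P : pred letter) : P l -> (absz (ldeg l) <= \sum_(l <- w | P l) absz (ldeg l))%N.
  by move=> Pl; rewrite (big_rem l) //= Pl leq_addr.
have [tl|tl] := boolP (is_t l).
  by apply: leq_trans (le_l _ tl) (leq_trans leT muB).
by apply: leq_trans (le_l (fun l => ~~ is_t l) tl) _; rewrite -/D; lia.
Qed.

(** Any [k'] above [k] is allowed, so that P^(k) and P^(k+1) can be summed over the same words. *)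
Lemma Pop_words B k' k m f mu : (0 < k)%N -> (k <= k')%N ->
  (weight mu <= B)%N -> (weight mu)%:Z + m <= B%:Z ->
  Pop k m f mu = \sum_(w <- words B k') word_term k m f mu w.
Proof.
move=> k0 kk' muB mumB; rewrite /Pop (fsbigE (words B k')) ?words_uniq //.
  by rewrite big_mkcond /=; apply: eq_bigr => w _; rewrite ifT // inE.
move=> w _; apply: contraNeq => /(word_term_support k0 muB mumB).
by rewrite !mem_words => /andP[/leq_trans-> //].
Qed.

(** Derivatives commute, so a leading one may be applied to the argument before all others. *)
Lemma act_normal_inr p w f :
  act_word (normal_order (inr p :: w)) f = act_word (normal_order w) (diff_t p f).
Proof.
rewrite /act_word /normal_order /= !foldr_cat; congr foldr => /=.
elim: w => //= -[n|n] w IHw //=; rewrite -IHw; exact: diff_tC.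
Qed.

(** Sort the words by their first letter: t_p gives J_{-p} on the left, while d/dt_p is carried to
    the right by normal ordering; together they form [nord]. Differentiating z^(-m-k) gives the
    factor -(m + k). *)
Lemma PopS k m f : (0 < k)%N ->
  Pop k.+1 m f = nord (fun m' f' => Pop k m' f') m f - (m + k%:Z)%:~R *: (Pop k m f : V).
Proof.
move=> k0; apply/funext => mu; pose B := (weight mu + absz m)%N.
rewrite (@Pop_words B k.+1) //; last 2 first; [by rewrite leq_addr | by rewrite /B; lia |].
rewrite -/B seriesD seriesN seriesZ.
have wt w : word_term k.+1 m f mu w
   = - ((m + k%:Z)%:~R *: word_term k m f mu w)
     + mulF Jfield (Pfield k) (- m - k.+1%:Z) w *: act_word (normal_order w) f mu.
  rewrite /word_term; case: k k0 => // k _; rewrite /Pfield /= {1}/addF scalerDl; congr (_ + _).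
  have e1 : - m - k.+2%:Z + 1 = - m - k.+1%:Z by lia.
  by rewrite /derivF e1 -scalerA -opprD mulrNz scaleNr.
rewrite (eq_bigr _ (fun w _ => wt w)) big_split /= addrC sumrN -scaler_sumr; congr (_ - _ *: _).
  rewrite big_cons mulF_Jfield_nil scale0r add0r big_allpairs_dep /= big_cat !big_map /=.
  rewrite /nord /nord_upto series_sum -/B.
  under [in RHS]eq_bigr do rewrite seriesD.
  rewrite big_split /= -!(sum_posnats B); congr (_ + _); apply: eq_big_seq => p.
    rewrite mem_posnats => pB; rewrite current_Negz seriesZ /mul_t.
    under eq_bigr do rewrite mulF_Jfield -scalerA.
    rewrite -scaler_sumr; congr (_ *: _); case: ifP => pmu; last first.
      by rewrite big1 // => w _; rewrite scaler0.
    have ewt := weight_msetB1 pmu.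
    rewrite (@Pop_words B k) //; last 2 first; [by rewrite /B ewt; lia|by rewrite /B ewt; lia|].
    by apply: eq_bigr => w _; rewrite /word_term; congr (Pfield _ _ _ *: _) => /=; lia.
  rewrite mem_posnats => pB; rewrite current_Posz.
  rewrite (@Pop_words B k) //; last 2 first; [by rewrite /B; lia|by rewrite /B; lia|].
  apply: eq_bigr => w _; rewrite mulF_Jfield act_normal_inr mul1r /word_term.
  by congr (Pfield _ _ _ *: _) => /=; lia.
by rewrite (@Pop_words B k.+1) //; rewrite /B; lia.
Qed.

Lemma Pop1 m f : Pop 1 m f = current m f.
Proof.
apply/funext => mu; pose B := (weight mu + absz m)%N.
rewrite (@Pop_words B 1) //; last 2 first; [by rewrite leq_addr | by rewrite /B; lia |].
rewrite -[words B 1]/([::] :: [seq l :: w | l <- letters B, w <- words B 0]).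
rewrite big_cons big_allpairs_dep /word_term scale0r add0r.
under eq_bigr do rewrite big_seq1.
rewrite big_cat !big_map /= /act_word /Pfield /=.
have : (absz m <= B)%N by rewrite leq_addl.
case: (currentP m) => [p|p|] mB; rewrite ?current0 ?current_Posz ?current_Negz.
- have p0 : (0 < val p)%N := valP p.
  rewrite big1 ?add0r => [|r _]; last first.
    by case: r => r r0; rewrite ifF ?scale0r //; lia.
  have pB : p \in posnats B by rewrite mem_posnats; move: mB; rewrite ?abszN absz_nat.
  rewrite (bigD1_seq p pB (posnats_uniq B)) /=.
  rewrite ifT; last exact: eqxx.
  rewrite scale1r big1 ?addr0 // => r rp; rewrite ifF ?scale0r //.
  by apply: contraNF rp => e; apply/eqP/val_inj; rewrite /= in e *; lia.
- have p0 : (0 < val p)%N := valP p.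
  rewrite addrC big1 ?add0r => [|r _]; last first.
    by case: r => r r0; rewrite ifF ?scale0r //; lia.
  have pB : p \in posnats B by rewrite mem_posnats; move: mB; rewrite ?abszN absz_nat.
  rewrite (bigD1_seq p pB (posnats_uniq B)) /=.
  rewrite ifT; last by rewrite opprK; exact: eqxx.
  rewrite seriesZ big1 ?addr0 // => r rp; rewrite ifF ?scale0r //.
  by apply: contraNF rp => e; apply/eqP/val_inj; rewrite /= in e *; lia.
by rewrite !big1 ?addr0 // => -[r r0] _ /=; rewrite ifF ?scale0r //; lia.
Qed.

Lemma Pop_Qfam k m f : (0 < k)%N -> Pop k m f = k`!%:R *: Qfam k m f.
Proof.
case: k => // k _; elim: k m f => [|k IHk] m f.
  by rewrite Pop1 -Jpow1 scale1r /= invr1 scale1r scale0r subr0 famD famN /fdeg /fone;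
    case: eqP => [->|_]; rewrite ?scale0r ?scaler0 oppr0 addr0.
rewrite PopS // (_ : (fun m' f' => Pop k.+1 m' f') = k.+1`!%:R *: Qfam k.+1); last first.
  by apply/funext => m'; apply/funext => f'; rewrite IHk.
have eQ : Qfam k.+2 = (k.+2%:R)^-1 *: (nord (Qfam k.+1) - fdeg (Qfam k.+1) - k.+1%:R *: Qfam k.+1) :> fam A by [].
have -> : nord (k.+1`!%:R *: Qfam k.+1) = k.+1`!%:R *: nord (Qfam k.+1) :> fam A by exact: linearZ.
rewrite IHk eQ; move: (Qfam k.+1) => Q.
have fk : k.+2`!%:R = k.+2%:R * k.+1`!%:R :> rat by rewrite factS natrM.
have k0 : k.+2%:R != 0 :> rat by rewrite pnatr_eq0.
have mk : (m + k.+1)%:~R = m%:~R + k.+1%:R :> rat by rewrite intrD.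
rewrite !(famZ, famD, famN) /fdeg fk mk.
move: (k.+1`!%:R : rat) (nord _ m f) (Q m f) (m%:~R : rat) => c x y u.
rewrite [in RHS]scalerA mulrAC mulfV // mul1r.
by lmod_start; lmod x; lmod y; rewrite ?oppr0 eqxx.
Qed.
End Words.

(** * Cycles of permutations *)

Section CycleType.
Import GroupScope.
Local Open Scope ring_scope.
Variable T : finType.
Implicit Types (s : {perm T}) (x y z : T).

Definition cycle_sizes s : seq nat := [seq #|X| | X : {set T} <- enum (porbits s)].

Lemma porbit_tperm_out s x y z : z \notin porbit s x -> z \notin porbit s y ->
  porbit (tperm x y * s)%g z = porbit s z.
Proof.
rewrite !(porbit_sym s z) => zx zy.
have exp_id n : ((tperm x y * s) ^+ n)%g z = (s ^+ n)%g z.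
  elim: n => [|n IHn]; first by rewrite !expg0.
  rewrite !expgSr !permM {}IHn tpermD //.
    by apply: contraNneq zx => ->; apply: mem_porbit.
  by apply: contraNneq zy => ->; apply: mem_porbit.
by apply/finset.setP => u; apply/porbitP/porbitP => -[i ->]; exists i; rewrite exp_id.
Qed.

Definition out_orbits s x y := (porbits s :\ porbit s y :\ porbit s x)%SET.

Lemma mem_out_orbits s x y Z : Z \in out_orbits s x y ->
  exists2 z, Z = porbit s z & (z \notin porbit s x) && (z \notin porbit s y).
Proof.
rewrite !inE => /and3P[Zx Zy /imsetP[z _ e]]; exists z => //; move: Zx Zy.
by rewrite e !eq_porbit_mem => -> ->.
Qed.

Lemma porbitU_tperm_sub s x y :
  (porbit (tperm x y * s)%g x :|: porbit (tperm x y * s)%g y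
     \subset porbit s x :|: porbit s y)%SET.
Proof.
apply/fintype.subsetP => z; rewrite !inE; apply: contraLR; rewrite !negb_or => /andP[zx zy].
by rewrite !(porbit_sym _ z) porbit_tperm_out // -!(porbit_sym s z) zx zy.
Qed.

Lemma tpermKl s x y : (tperm x y * (tperm x y * s) = s)%g.
Proof. by rewrite mulgA tperm2 mul1g. Qed.

Lemma porbitU_tperm s x y :
  (porbit (tperm x y * s)%g x :|: porbit (tperm x y * s)%g y
     = porbit s x :|: porbit s y)%SET.
Proof.
apply/eqP; rewrite finset.eqEsubset porbitU_tperm_sub /=.
by rewrite -{1 2}(tpermKl s x y) porbitU_tperm_sub.
Qed.

Lemma out_orbits_tperm_sub s x y :
  out_orbits s x y \subset out_orbits (tperm x y * s)%g x y.
Proof.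
apply/fintype.subsetP => Z /mem_out_orbits[z -> /andP[zx zy]].
have e := porbit_tperm_out zx zy.
rewrite !inE -e !eq_porbit_mem ![z \in porbit (_ * _)%g _]porbit_sym e.
by rewrite -!(porbit_sym s z) zx zy /= -e imset_f.
Qed.

Lemma out_orbits_tperm s x y :
  out_orbits (tperm x y * s)%g x y = out_orbits s x y.
Proof.
apply/eqP; rewrite finset.eqEsubset out_orbits_tperm_sub andbT.
by rewrite -{2}(tpermKl s x y) out_orbits_tperm_sub.
Qed.

Lemma card_porbits_out s x y :
  #|porbits s| = ((porbit s x != porbit s y).+1 + #|out_orbits s x y|)%N.
Proof.
rewrite (cardsD1 (porbit s y)) imset_f // (cardsD1 (porbit s x)) !inE imset_f // andbT.
by rewrite /out_orbits addnA add1n.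
Qed.

Lemma cycle_sizes_out2 s x y : porbit s x != porbit s y ->
  perm_eq (cycle_sizes s)
    (#|porbit s x| :: #|porbit s y| :: [seq #|X| | X : {set T} <- enum (out_orbits s x y)]).
Proof.
move=> xy; apply: (@perm_map _ _ _ _ [:: porbit s x, porbit s y & _]).
apply: uniq_perm; first exact: enum_uniq.
  rewrite /= inE negb_or xy /= !mem_enum /out_orbits !in_setD1 !eqxx /= andbF.
  exact: enum_uniq.
move=> Z; rewrite !inE !mem_enum !in_setD1.
by have [->|Zx] := eqVneq Z (porbit s x); rewrite ?imset_f //;
   have [->|Zy] := eqVneq Z (porbit s y); rewrite ?imset_f // ?orbT.
Qed.

Lemma cycle_sizes_out1 s x y : porbit s x = porbit s y ->
  perm_eq (cycle_sizes s)
    (#|porbit s x| :: [seq #|X| | X : {set T} <- enum (out_orbits s x y)]).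
Proof.
move=> xy; apply: (@perm_map _ _ _ _ [:: porbit s x & _]).
apply: uniq_perm; first exact: enum_uniq.
  by rewrite /= !mem_enum /out_orbits !in_setD1 !eqxx enum_uniq.
move=> Z; rewrite !inE !mem_enum !in_setD1 -xy.
by have [->|Zx] := eqVneq Z (porbit s x); rewrite ?imset_f.
Qed.

Lemma enum_rem2 s x y : porbit s x != porbit s y ->
  perm_eq (enum (out_orbits s x y))
    (rem (porbit s y) (rem (porbit s x) (enum (porbits s)))).
Proof.
move=> xy; apply: uniq_perm; rewrite ?rem_uniq ?enum_uniq // => Z.
rewrite !(mem_rem_uniq, rem_uniq, inE, enum_uniq, mem_enum) //.
by rewrite andbCA.
Qed.

Lemma enum_rem1 s x y : porbit s x = porbit s y ->
  perm_eq (enum (out_orbits s x y)) (rem (porbit s x) (enum (porbits s))).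
Proof.
move=> xy; apply: uniq_perm; rewrite ?rem_uniq ?enum_uniq // => Z.
by rewrite !(mem_rem_uniq, inE, enum_uniq, mem_enum) // xy andbA andbb.
Qed.

(** Cycles avoiding x and y are unchanged, as is the union of the cycles of x and y; since the
    number of cycles changes by one, these two become a single cycle. *)
Lemma cycle_sizes_join s x y : y \notin porbit s x ->
  perm_eq (cycle_sizes (tperm x y * s)%g)
    ((#|porbit s x| + #|porbit s y|)%N
      :: [seq #|X| | X : {set T} <- rem (porbit s y) (rem (porbit s x) (enum (porbits s)))]).
Proof.
move=> yx; have xy : porbit s x != porbit s y by rewrite eq_porbit_mem porbit_sym.
have nxy : x != y by apply: contraNneq yx => ->; rewrite porbit_id.
have := porbits_mul_tperm s x y; rewrite /= porbit_sym yx nxy.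
rewrite (card_porbits_out s x y) (card_porbits_out (_ * _)%g x y) out_orbits_tperm xy /=.
case: eqP => [e _|_ /=]; last by lia.
have cXY : #|porbit (tperm x y * s)%g x| = (#|porbit s x| + #|porbit s y|)%N.
  have := porbitU_tperm s x y; rewrite -e finset.setUid => ->; rewrite cardsU.
  rewrite [X in (_ - X)%N](_ : _ = 0%N) ?subn0 //; apply/eqP; rewrite cards_eq0.
  apply/finset.set0Pn => -[z]; rewrite inE => /andP[zx zy]; case/negP: xy.
  by move: zx zy; rewrite -!eq_porbit_mem => /eqP<- /eqP->.
rewrite (perm_trans (cycle_sizes_out1 e)) // cXY out_orbits_tperm perm_cons.
exact/perm_map/enum_rem2.
Qed.

Lemma perm_exp_inj s x i j : (i < #|porbit s x|)%N -> (j < #|porbit s x|)%N ->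
  (s ^+ i)%g x = (s ^+ j)%g x -> i = j.
Proof.
move=> ix jx; rewrite !permX => e; apply/eqP.
rewrite -(nth_uniq x _ _ (uniq_traject_porbit s x)) ?size_traject //.
by rewrite !nth_traject // e.
Qed.

Lemma card_porbit_le s x p : (0 < p)%N -> (s ^+ p)%g x = x -> (#|porbit s x| <= p)%N.
Proof.
move=> p0 e; have sub : porbit s x \subset [set (s ^+ (i : 'I_p))%g x | i : 'I_p]%SET.
  apply/fintype.subsetP => z /porbitP[k ->]; apply/imsetP.
  exists (Ordinal (ltn_pmod k p0)) => //=.
  rewrite {1}(divn_eq k p) expgD permM mulnC expgM; congr (_ _).
  by elim: (k %/ p)%N => [|n IHn]; rewrite ?expg0 ?perm1 // expgSr permM IHn.
apply: leq_trans (subset_leq_card sub) _.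
by apply: leq_trans (leq_imset_card _ _) _; rewrite card_ord.
Qed.

(** The new cycles of x and y have at most n - i and i points, and they fill the old cycle of n
    points, so both bounds are attained. *)
Lemma cycle_sizes_cut s x i : (0 < i < #|porbit s x|)%N ->
  perm_eq (cycle_sizes (tperm x ((s ^+ i)%g x) * s)%g)
    (i :: (#|porbit s x| - i)%N :: [seq #|X| | X : {set T} <- rem (porbit s x) (enum (porbits s))]).
Proof.
set n := #|_|; move=> /andP[i0 i_n]; set y := (s ^+ i)%g x; set s' := (_ * s)%g.
have yx : porbit s x = porbit s y by rewrite porbit_perm.
have nxy : x != y.
  apply/eqP => e; have : 0%N = i by apply: (@perm_exp_inj s x); rewrite ?expg0 ?perm1 // (leq_trans i0) // ltnW.
  by lia.
have := porbits_mul_tperm s x y; rewrite /= -eq_porbit_mem yx eqxx nxy /= addn0 -/s'.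
rewrite (card_porbits_out s x y) (card_porbits_out s' x y) out_orbits_tperm yx eqxx /=.
have [_|xy' _] := eqVneq (porbit s' x) (porbit s' y); first by lia.
have nx k : (0 < k < n)%N -> (s ^+ k)%g x != x.
  move=> /andP[k0 kn]; apply/eqP => e.
  have k00 : k = 0%N by apply: (@perm_exp_inj s x); rewrite ?expg0 ?perm1 // -/n; lia.
  by lia.
have ny k : (k < n)%N -> k != i -> (s ^+ k)%g x != y.
  move=> kn; apply: contraNneq => e.
  by apply/eqP; apply: (@perm_exp_inj s x).
(* The left factor acts first: x goes to y and on to s y, so its new orbit runs through s^(i+1) x,
   ..., s^n x = x. *)
have A j : (j < n - i)%N -> (s' ^+ j.+1)%g x = (s ^+ (i + j.+1))%g x.
  elim: j => [|j IHj] ji; first by rewrite expg1 permM tpermL addn1 expgSr permM.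
  rewrite expgSr permM IHj ?(ltnW ji) // permM tpermD; last 2 first.
  - by rewrite eq_sym nx //; lia.
  - by rewrite eq_sym ny //; lia.
  by rewrite [(i + j.+2)%N]addnS [in RHS]expgSr permM.
have B j : (j < i)%N -> (s' ^+ j.+1)%g y = (s ^+ j.+1)%g x.
  elim: j => [|j IHj] ji; first by rewrite !expg1 permM tpermR.
  rewrite expgSr permM IHj ?(ltnW ji) // permM tpermD; last 2 first.
  - by rewrite eq_sym nx //; lia.
  - by rewrite eq_sym ny //; lia.
  by rewrite [in RHS]expgSr permM.
have lx : (#|porbit s' x| <= n - i)%N.
  apply: card_porbit_le; first by lia.
  have -> : (n - i = (n - i).-1.+1)%N by lia.
  rewrite A; last by lia.
  have -> : (i + (n - i).-1.+1 = n)%N by lia.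
  by rewrite permX iter_porbit.
have ly : (#|porbit s' y| <= i)%N.
  apply: card_porbit_le => //.
  have -> : (i = i.-1.+1)%N by lia.
  by rewrite B ?prednK //; lia.
have cU : (#|porbit s' x| + #|porbit s' y| = n)%N.
  have d0 : (porbit s' x :&: porbit s' y = finset.set0)%SET.
    apply/finset.setP => z; rewrite !inE; apply: contraNF xy' => /andP[].
    by rewrite -!eq_porbit_mem => /eqP<- /eqP->.
  rewrite -cardsUI d0 cards0 addn0.
  by rewrite /s' porbitU_tperm -yx finset.setUid.
have ex : #|porbit s' x| = (n - i)%N by lia.
have ey : #|porbit s' y| = i by lia.
rewrite (perm_trans (cycle_sizes_out2 xy')) // ex ey out_orbits_tperm.
rewrite -cat1s -(cat1s i) perm_catCA /= !perm_cons -yx.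
exact/perm_map/enum_rem1.
Qed.

Lemma sum_porbit (M : nmodType) s x (F : T -> M) :
  \sum_(y in porbit s x) F y = \sum_(0 <= i < #|porbit s x|) F ((s ^+ i)%g x).
Proof.
rewrite -big_enum /= (perm_big (traject s x #|porbit s x|)).
  rewrite -[in LHS](size_traject s x #|porbit s x|) (big_nth x) size_traject !size_traject.
  by apply: eq_big_nat => i /andP[_ ix]; rewrite nth_traject // permX.
apply: uniq_perm; rewrite ?enum_uniq ?uniq_traject_porbit // => z.
by rewrite mem_enum porbit_traject.
Qed.

End CycleType.

Section SumOrbits.
Variables (T : finType) (M : nmodType) (s : {perm T}).

Lemma sum_porbits (F : {set T} -> M) :
  \sum_x F (porbit s x) = \sum_(X <- enum (porbits s)) F X *+ #|X|.
Proof.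
rewrite big_enum /= (partition_big (porbit s) (mem (porbits s))) /=; last first.
  by move=> x _; apply: imset_f.
apply: eq_bigr => X /imsetP[x0 _ ->].
rewrite -sumr_const; apply: eq_big => [x|x]; first by rewrite eq_porbit_mem.
by move/eqP->.
Qed.

Lemma sum_porbits_out x (F : {set T} -> M) :
  \sum_(y | y \notin porbit s x) F (porbit s y)
    = \sum_(Y <- rem (porbit s x) (enum (porbits s))) F Y *+ #|Y|.
Proof.
rewrite rem_filter ?enum_uniq // big_filter.
transitivity (\sum_y if porbit s y != porbit s x then F (porbit s y) else 0).
  by rewrite big_mkcond /=; apply: eq_bigr => y _; rewrite eq_porbit_mem.
rewrite (sum_porbits (fun Y => if Y != porbit s x then F Y else 0)) [RHS]big_mkcond /=.
by apply: eq_bigr => Y _; case: ifP; rewrite ?mul0rn.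
Qed.
End SumOrbits.

(** The weights in [cutjoin_psum] count points: |X| counts the x in X, the cut at i corresponds to y
    = s^i x, and |Y| counts the y in another cycle. Hence D is half a sum over ordered pairs. *)
Lemma cutjoin_cycles (A : lmodType rat) (a : A) (T : finType) (s : {perm T}) :
  cutjoin (psum a (cycle_sizes s)) =
  2^-1 *: \sum_x \sum_(y | y != x) psum a (cycle_sizes (tperm x y * s)%g).
Proof.
rewrite /cycle_sizes cutjoin_psum ?enum_uniq //; congr (_ *: _).
pose H (X : {set T}) : series A :=
  \sum_(1 <= i < #|X|) psum a (i :: (#|X| - i)%N :: [seq #|Z| | Z : {set T} <- rem X (enum (porbits s))])
  + \sum_(Y <- rem X (enum (porbits s))) #|Y|%:R *: psum a ((#|X| + #|Y|)%N
       :: [seq #|Z| | Z : {set T} <- rem Y (rem X (enum (porbits s)))]).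
transitivity (\sum_x H (porbit s x)).
  by rewrite sum_porbits; apply: eq_bigr => X _; rewrite scaler_nat.
apply: eq_bigr => x _; rewrite (bigID (mem (porbit s x))) /=; congr (_ + _).
  transitivity (\sum_(y in porbit s x) if y != x then psum a (cycle_sizes (tperm x y * s)%g) else 0).
    rewrite sum_porbit [RHS]big_ltn; last by rewrite lt0n card_porbit_neq0.
    rewrite expg0 perm1 eqxx add0r; apply: eq_big_nat => i /andP[i0 i_n].
    rewrite ifT; first by apply/esym/psum_perm/cycle_sizes_cut; rewrite i0.
    apply/eqP => e; have : i = 0%N; last by lia.
    apply: (@perm_exp_inj _ s x) => //; last by rewrite expg0 perm1.
    by apply: leq_trans i_n.
  by rewrite -big_mkcondr; apply: eq_bigl => y; rewrite andbC.
transitivity (\sum_(y | y \notin porbit s x) psum a ((#|porbit s x| + #|porbit s y|)%N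
       :: [seq #|Z| | Z : {set T} <- rem (porbit s y) (rem (porbit s x) (enum (porbits s)))])).
  rewrite (sum_porbits_out s x (fun Y => psum a ((#|porbit s x| + #|Y|)%N
       :: [seq #|Z| | Z : {set T} <- rem Y (rem (porbit s x) (enum (porbits s)))]))).
  by apply: eq_bigr => Y _; rewrite scaler_nat.
apply: eq_big => [y|y yx]; last by apply/esym/psum_perm/cycle_sizes_join.
have [->|//] := eqVneq y x; by rewrite porbit_id.
Qed.

(** * Permutations of d + 1 points in terms of those of d points *)

Section Lift.
Variable d : nat.
Implicit Types b : 'S_d.
(* Every permutation of d + 1 points is uniquely tau * liftp b with tau the
   identity or a transposition moving the last point. *)
Definition liftp b : 'S_d.+1 := lift_perm ord_max ord_max b.

Lemma liftpM b c : liftp (b * c)%g = (liftp b * liftp c)%g.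
Proof. by rewrite /liftp lift_permM. Qed.

Lemma liftpX b n : liftp (b ^+ n)%g = (liftp b ^+ n)%g.
Proof. by elim: n => [|n IHn]; rewrite ?expg0 ?expgS ?liftpM ?IHn // /liftp lift_perm1. Qed.

Lemma porbit_liftp_max b : porbit (liftp b) ord_max = [set ord_max]%SET.
Proof.
apply/finset.setP => z; rewrite inE; apply/porbitP/eqP => [[i ->]|->].
  by rewrite -liftpX lift_perm_id.
by exists 0%N; rewrite expg0 perm1.
Qed.

Lemma porbit_liftp b k :
  porbit (liftp b) (lift ord_max k) = [set lift ord_max z | z in porbit b k]%SET.
Proof.
apply/finset.setP => z; apply/porbitP/imsetP => [[i ->]|[y /porbitP[i ->] ->]].
  by exists ((b ^+ i)%g k); rewrite ?mem_porbit // -liftpX /liftp lift_perm_lift.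
by exists i; rewrite -liftpX /liftp lift_perm_lift.
Qed.

Lemma cycle_sizes_liftp b : perm_eq (cycle_sizes (liftp b)) (1%N :: cycle_sizes b).
Proof.
pose L (X : {set 'I_d}) : {set 'I_d.+1} := [set lift ord_max z | z in X]%SET.
have cL X : #|L X| = #|X| by apply: card_imset; exact: lift_inj.
have -> : 1%N :: cycle_sizes b
    = [seq #|X| | X : {set 'I_d.+1} <- [set ord_max]%SET :: map L (enum (porbits b))].
  by rewrite /= cards1 -map_comp; congr (_ :: _); apply: eq_map => X /=; rewrite cL.
apply/perm_map/uniq_perm; first exact: enum_uniq.
  rewrite /= map_inj_uniq ?enum_uniq ?andbT; last by apply: imset_inj; exact: lift_inj.
  apply/mapP => -[X _ /finset.setP /(_ ord_max)]; rewrite inE eqxx => /esym/imsetP[z _ e].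
  by have := neq_lift ord_max z; rewrite -e eqxx.
move=> Z; rewrite mem_enum inE; apply/imsetP/idP => [[z _ ->]|].
  case: (unliftP ord_max z) => [k|] ->; last by rewrite porbit_liftp_max eqxx.
  by rewrite porbit_liftp; apply/orP; right; apply: map_f; rewrite mem_enum imset_f.
case/predU1P=> [->|/mapP[X]]; first by exists ord_max => //; rewrite porbit_liftp_max.
rewrite mem_enum => /imsetP[k _ ->] ->; exists (lift ord_max k) => //.
by rewrite porbit_liftp.
Qed.

Lemma ncycles_liftp b : ncycles (liftp b) = (ncycles b).+1.
Proof.
have /perm_size := cycle_sizes_liftp b.
by rewrite /= !size_map -!cardE.
Qed.

(** The lift adds the last point as a fixed point; a genuine transposition joins it to another cycle
    again. *)
Lemma ncycles_tperm_liftp b k :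
  ncycles (tperm k ord_max * liftp b)%g = (ncycles b + (k == ord_max))%N.
Proof.
have := porbits_mul_tperm (liftp b) k ord_max; rewrite porbit_liftp_max inE /=.
have := ncycles_liftp b; rewrite /ncycles => ->.
case: (k == ord_max) => /=; first by rewrite !addn0 => ->; rewrite addn1.
by rewrite addn1 addn2 => -[->]; rewrite addn0.
Qed.

Definition decomp (x : 'S_d * 'I_d.+1) : 'S_d.+1 := (tperm x.2 ord_max * liftp x.1)%g.

Lemma decomp_bij : bijective decomp.
Proof.
apply: inj_card_bij; last first.
  by rewrite card_prod !card_Sn card_ord factS mulnC.
move=> [b k] [c j]; rewrite /decomp /= => e.
(* The index is recovered as the preimage of the last point. *)
have kj : k = j.
  have : (tperm j ord_max * liftp c)%g k = ord_max by rewrite -e permM tpermL lift_perm_id.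
  have ej : (tperm j ord_max * liftp c)%g j = ord_max by rewrite permM tpermL lift_perm_id.
  by move=> ek; apply: (@perm_inj _ (tperm j ord_max * liftp c)%g); rewrite ek ej.
rewrite kj in e *; congr (_, _); have /permP e' := mulgI _ _ _ e.
apply/permP => z; have := e' (lift ord_max z); rewrite /liftp !lift_perm_lift.
exact: lift_inj.
Qed.
End Lift.

(** * The partition function *)

Lemma perm_msetB1 (p : posnat) (mu : ipartition) : p \in mu ->
  perm_eq (enum_mset mu) (p :: enum_mset (mu `\ p)%mset).
Proof.
move=> pmu; apply/allP => /= a _ /=.
rewrite !count_mem_mset msetB1E [p == a]eq_sym.
by case: (eqVneq a p) => [->|_]; rewrite ?subn0 // add1n subn1 prednK // -in_mset.
Qed.

Lemma psumE (A : lmodType rat) (a : A) (s : seq nat) mu : all (leq 1) s ->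
  psum a s mu = if perm_eq s [seq val n | n <- enum_mset mu]
                then (\prod_(n <- enum_mset mu) (val n)%:R) *: a else 0.
Proof.
elim: s mu => [|n s IHs] mu /=.
  move=> _; rewrite /vac; have [->|mu0] := eqVneq mu mset0.
    by rewrite enum_mset0 /= big_nil scale1r.
  rewrite perm_sym ifF //; apply: contraNF mu0 => /perm_nilP e; apply/eqP.
  apply/eqP; rewrite -size_mset_eq0 -(size_map val).
  by rewrite -[map _ _]/([seq val n | n <- enum_mset mu]) e.
case/andP=> n0 s0; pose p : posnat := exist _ n n0.
rewrite -[n]/(val p) current_Negz seriesZ /mul_t; case: ifP => pmu.
  rewrite IHs // (perm_big _ (perm_msetB1 pmu)) big_cons /=.
  have e : perm_eq [seq val n | n <- enum_mset mu] (n :: [seq val n | n <- enum_mset (mu `\ p)%mset]).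
    exact: (perm_map val (perm_msetB1 pmu)).
  rewrite (permPr e) perm_cons; case: ifP => _; last by rewrite scaler0.
  by rewrite scalerA.
rewrite scaler0 ifF //; apply: contraFF pmu => /perm_mem /(_ n).
rewrite mem_head => /esym/mapP[m mmu e].
by have -> : p = m by apply: val_inj.
Qed.

Lemma cycle_sizes_pos (T : finType) (s : {perm T}) : all (leq 1) (cycle_sizes s).
Proof.
apply/allP => n /mapP[X]; rewrite mem_enum => /imsetP[x _ ->] ->.
by rewrite lt0n card_porbit_neq0.
Qed.

Lemma sumn_cycle_sizes (T : finType) (s : {perm T}) : sumn (cycle_sizes s) = #|T|.
Proof.
rewrite sumnE big_map -sum1_card (sum_porbits s (fun=> 1%N)).
by apply: eq_bigr => X _; rewrite -[RHS]mulr_natl mulr1 natn.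
Qed.

Section Dessins.
Variable r : nat.
Local Notation A := {mpoly rat[r]}.

Definition cmono d (x : {ffun 'I_r -> 'S_d}) : A := \prod_(i < r) 'X_i ^+ ncycles (x i).

Definition dessin_sum d : series A :=
  \sum_(x : {ffun 'I_r -> 'S_d}) psum (cmono x) (cycle_sizes (\prod_(i < r) x i)%g).

Lemma dessin_sumE d mu : dessin_sum d mu =
  \sum_(x : {ffun 'I_r -> 'S_d})
    if perm_eq (cycle_sizes (\prod_(i < r) x i)%g) [seq val n | n <- enum_mset mu]
    then (\prod_(n <- enum_mset mu) (val n)%:R) *: cmono x else 0.
Proof.
by rewrite /dessin_sum series_sum; apply: eq_bigr => x _; rewrite psumE // cycle_sizes_pos.
Qed.

(** The last permutation is the inverse of the product of the others, and inversion preserves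
    cycles. *)
Lemma card_cover_tuples (k : {ffun 'I_r -> nat}) mu :
  #|cover_tuples k mu| = #|[set x : {ffun 'I_r -> 'S_(weight mu)} |
     ([ffun i => ncycles (x i)] == k) &&
     perm_eq (cycle_sizes (\prod_(i < r) x i)%g) [seq val n | n <- enum_mset mu]]%SET|.
Proof.
rewrite -(card_imset _ (_ : injective (fun x : {ffun 'I_r -> 'S_(weight mu)} =>
   (x, (\prod_(i < r) x i)^-1)%g))); last by move=> x y [].
apply: eq_card => -[x y]; apply/idP/imsetP => /=; rewrite ?inE /=.
  case/and3P=> /eqP e /forallP kx ty; exists x; last first.
    have -> : y = ((\prod_(i < r) x i)^-1)%g by apply/esym/eqP; rewrite eq_invg_mul e.
    by [].
  rewrite inE; apply/andP; split; first by apply/eqP/ffunP => i; rewrite ffunE; exact/eqP.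
  move: ty; rewrite /has_cycle_type /cycle_sizes.
  by rewrite -(mulKg (\prod_(i < r) x i)%g y) e mulg1 porbitsV.
case=> x'; rewrite inE => /andP[/eqP kx ty] [-> ->]; rewrite mulgV eqxx /=.
apply/andP; split; first by apply/forallP => i; rewrite -kx ffunE.
by rewrite /has_cycle_type porbitsV.
Qed.

Lemma p_to_t_Zdessin d mu :
  p_to_t (Zdessin r) d mu = (d`!%:R)^-1 *: dessin_sum d mu.
Proof.
rewrite /p_to_t /Zdessin dessin_sumE; case: eqP => [->|dmu]; last first.
  rewrite scaler0 big1 ?scaler0 // => x _; rewrite ifF //.
  apply: contra_notF dmu => /perm_sumn; rewrite sumn_cycle_sizes card_ord => ->.
  by rewrite sumnE big_map.
set c := \prod_(n <- _) _; set d' := weight mu.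
pose kx (x : {ffun 'I_r -> 'S_d'}) : {ffun 'I_r -> nat} := [ffun i => ncycles (x i)].
pose ty (x : {ffun 'I_r -> 'S_d'}) :=
  perm_eq (cycle_sizes (\prod_(i < r) x i)%g) [seq val n | n <- enum_mset mu].
(* The vectors of cycle counts that occur; [Nbullet] vanishes outside this list. *)
pose ks := undup [seq kx x | x : {ffun 'I_r -> 'S_d'} <- enum {ffun 'I_r -> 'S_d'}].
have kxs x : kx x \in ks by rewrite mem_undup map_f // mem_enum.
have NE (k : {ffun 'I_r -> nat}) : Nbullet k mu =
    (d'`!%:R)^-1 * \sum_(x : {ffun 'I_r -> 'S_d'} | ty x && (kx x == k)) (1 : rat).
  rewrite /Nbullet card_cover_tuples mulrC; congr (_ * _).
  rewrite -sum1_card natr_sum; apply: eq_bigl => x; rewrite inE andbC //.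
rewrite (fsbigE ks) ?undup_uniq // => [|k _ kks]; last first.
  rewrite NE big_pred0 ?mulr0 ?scale0r // => x; apply: contraNF kks => /andP[_ /eqP<-].
  exact: kxs.
rewrite big_mkcond /=.
under eq_bigr => k _ do rewrite ifT ?inE // NE -scalerA.
rewrite -scaler_sumr scalerA mulrC -scalerA; congr (_ *: _).
under eq_bigr => k _ do rewrite scaler_suml.
rewrite (exchange_big_dep ty) /=; last by move=> k x _ /andP[].
rewrite scaler_sumr big_mkcond /=; apply: eq_bigr => x _.
rewrite -[X in _ = if X then _ else _]/(ty x); case: ifP => // tx.
congr (_ *: _); rewrite (big_rem (kx x)) //= tx eqxx /= scale1r [X in _ + X]big_seq_cond [X in _ + X]big_pred0 ?addr0.
  by apply: eq_bigr => i _; rewrite ffunE.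
move=> k; rewrite rem_filter ?undup_uniq // mem_filter /= eq_sym.
by case: eqP; rewrite ?andbF.
Qed.
End Dessins.

(** * Jucys-Murphy telescoping *)

Section AdPowers.
Variable A : lmodType rat.
Implicit Types (f : series A) (a : A).

(* The k-th iterated commutator of cutjoin with p_1. *)
Fixpoint adt k f : series A :=
  if k is k'.+1 then cutjoin (adt k' f) - adt k' (cutjoin f) else current (-1) f.

Fact adt_is_linear k : linear (adt k).
Proof.
elim: k => [|k IHk] c f g /=; first exact: linearP.
have cD u v : cutjoin (c *: u + v) = c *: cutjoin u + cutjoin v :> series A by exact: linearP.
by rewrite IHk !cD IHk scalerBr opprD addrACA.
Qed.
HB.instance Definition _ k :=
  GRing.isLinear.Build rat (series A) (series A) *:%R (adt k) (adt_is_linear k).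

(** The domain on which the commutators with [cutjoin] are known. *)
Definition polyn f := exists r : seq (A * seq nat), f = \sum_(x <- r) psum x.1 x.2.

Lemma polyn_psum a s : polyn (psum a s).
Proof. by exists [:: (a, s)]; rewrite big_seq1. Qed.

Lemma polynD f g : polyn f -> polyn g -> polyn (f + g).
Proof. by move=> [r ->] [r' ->]; exists (r ++ r'); rewrite big_cat. Qed.

Lemma polynZ c f : polyn f -> polyn (c *: f).
Proof.
move=> [r ->]; exists [seq (c *: x.1, x.2) | x <- r].
by rewrite big_map scaler_sumr; apply: eq_bigr => x _; rewrite psumZ.
Qed.

Lemma polyn_sum (I : Type) (r : seq I) (F : I -> series A) :
  (forall i, polyn (F i)) -> polyn (\sum_(i <- r) F i).
Proof.
move=> pF; apply: big_ind => //; last exact: polynD.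
by exists [::]; rewrite big_nil.
Qed.

Lemma polyn_cutjoin f : polyn f -> polyn (cutjoin f).
Proof.
move=> [r ->]; rewrite linear_sum; apply: polyn_sum => -[a s] /=.
(* Positions serve as the distinct labels required by [cutjoin_psum]. *)
have -> : s = map (nth 0%N s) (iota 0 (size s)) by rewrite -/(mkseq _ _) mkseq_nth.
rewrite cutjoin_psum ?iota_uniq //; apply/polynZ/polyn_sum => X; apply/polynZ/polynD.
  by apply: polyn_sum => i; exact: polyn_psum.
by apply: polyn_sum => Y; apply/polynZ/polyn_psum.
Qed.

Lemma comm_cutjoin_polyn k f : polyn f ->
  cutjoin (Qfam k (-1) f) - Qfam k (-1) (cutjoin f)
    = k%:R *: Qfam k.+1 (-1) f + (k%:R - 1) *: Qfam k (-1) f.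
Proof.
move=> [r ->]; have gQ := @graded_Qfam A.
have cS (F : A * seq nat -> series A) :
    cutjoin (\sum_(x <- r) F x) = \sum_(x <- r) cutjoin (F x) by exact: linear_sum.
rewrite cS !(graded_sum _ _ _ (gQ _)) cS -sumrB.
rewrite !scaler_sumr -big_split; apply: eq_bigr => x _; exact: comm_cutjoin_Qfam.
Qed.

Definition falling (R : nzRingType) i : {poly R} := \prod_(j < i) ('X - (j%:R)%:P).

Lemma fallingS (R : nzRingType) i : falling R i.+1 = falling R i * ('X - (i%:R)%:P).
Proof. by rewrite /falling big_ord_recr. Qed.

Lemma size_falling (R : nzRingType) i : size (falling R i) = i.+1.
Proof. by rewrite size_prod_XsubC /index_enum -enumT size_enum_ord. Qed.

(** Apply ad(D) - i to the previous case: in [D, Q_(i+1)] = (i + 1) Q_(i+2) + i Q_(i+1) the last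
    term cancels. *)
Lemma adt_falling i f : polyn f ->
  \sum_(0 <= k < i.+1) (falling rat i)`_k *: adt k f = i`!%:R *: Qfam i.+1 (-1) f.
Proof.
elim: i f => [|i IHi] f pf.
  rewrite big_nat1 /falling big_ord0 coef1 !scale1r /=.
  rewrite -Jpow1 invr1 scale1r scale0r subr0 famD famN /fdeg /fone.
  by rewrite scaler0 subr0.
have e k : (falling rat i.+1)`_k
   = (if k is k'.+1 then (falling rat i)`_k' else 0) - i%:R * (falling rat i)`_k.
  by rewrite fallingS mulrBr coefB coefMX coefMC mulrC; case: k.
under eq_bigr => k _ do rewrite e scalerBl.
rewrite sumrB big_nat_recl // scale0r add0r.
rewrite [X in _ - X]big_nat_recr // [X in _ - (_ + X)](_ : _ = 0) ?addr0; last first.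
  by rewrite (_ : (falling rat i)`_i.+1 = 0) ?mulr0 ?scale0r // nth_default // size_falling.
have cZ u v : cutjoin (u *: v) = u *: cutjoin v :> series A by exact: linearZ.
have cS (F : nat -> series A) : cutjoin (\sum_(0 <= k < i.+1) F k)
  = \sum_(0 <= k < i.+1) cutjoin (F k) by exact: linear_sum.
rewrite [X in X - _](_ : _ = cutjoin (i`!%:R *: Qfam i.+1 (-1) f)
    - i`!%:R *: Qfam i.+1 (-1) (cutjoin f)); last first.
  rewrite -(IHi f pf) -(IHi _ (polyn_cutjoin pf)) cS -sumrB; apply: eq_bigr => k _.
  by rewrite cZ -scalerBr.
rewrite [X in _ - X](_ : _ = i%:R *: (i`!%:R *: Qfam i.+1 (-1) f)); last first.
  by rewrite -IHi // scaler_sumr; apply: eq_bigr => k _; rewrite scalerA.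
rewrite cZ -scalerBr comm_cutjoin_polyn // factS natrM -natr1.
move: (Qfam i.+2 _ f) (Qfam i.+1 _ f) => x y.
by lmod_start; lmod x; lmod y; rewrite ?oppr0 eqxx.
Qed.
End AdPowers.

(** * Sums over tuples of permutations, from d to d + 1 points *)

Section Nest.
Variable A : comAlgType rat.
Implicit Types (vs : seq A) (c v : A).
Local Notation V := (series A).

(** The sum over tuples of permutations, nested so that factors can be treated one at a time: [c]
    accumulates the monomial and [s] the product. *)
Fixpoint nest d vs (F : A -> 'S_d -> V) c s : V :=
  if vs is v :: vs' then \sum_(b : 'S_d) nest vs' F (v ^+ ncycles b * c) (s * b)%g
  else F c s.

Lemma nest_sum d vs (I : Type) (r : seq I) (F : I -> A -> 'S_d -> V) c s :
  \sum_(i <- r) nest vs (F i) c s = nest vs (fun c' s' => \sum_(i <- r) F i c' s') c s.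
Proof.
elim: vs c s => //= v vs IHvs c s.
by rewrite exchange_big; apply: eq_bigr => b _; rewrite IHvs.
Qed.

Lemma nest_coef d vs (F : A -> 'S_d -> V) u c s :
  nest vs F (u * c) s = nest vs (fun c' s' => F (u * c') s') c s.
Proof.
by elim: vs c s => //= v vs IHvs c s; apply: eq_bigr => b _; rewrite -IHvs mulrCA.
Qed.

Lemma eq_nest d vs (F G : A -> 'S_d -> V) c s :
  (forall c' s', F c' s' = G c' s') -> nest vs F c s = nest vs G c s.
Proof. by move=> FG; elim: vs c s => //= v vs IHvs c s; apply: eq_bigr. Qed.

Variable d : nat.
Local Notation Psi := (fun c (s : 'S_d.+1) => psum c (cycle_sizes s)).
Local Notation tau k := (tperm k (@ord_max d)).
(** By [ncycles_tperm_liftp], tau contributes one more factor v exactly when it is the identity. *)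
Definition jmw v (k : 'I_d.+1) : A := if k == ord_max then v else 1.

(* Expands the product over v of (v + the Jucys-Murphy element of the last
   point), placed between p and liftp s. *)
Fixpoint TT vs c (p : 'S_d.+1) (s : 'S_d) : V :=
  if vs is v :: vs' then \sum_k TT vs' (jmw v k * c) (p * tau k)%g s
  else Psi c (p * liftp s)%g.

Lemma liftp_tau (b : 'S_d) k : (liftp b * tau k = tau ((liftp b)^-1 k) * liftp b)%g.
Proof.
have -> : tau ((liftp b)^-1%g k) = tperm ((liftp b)^-1%g k) ((liftp b)^-1%g ord_max).
  by congr tperm; rewrite /liftp lift_permV lift_perm_id.
by rewrite -tpermJ conjgE invgK -!mulgA mulVg mulg1.
Qed.

Lemma sum_jm (b : 'S_d) v (F : A -> 'I_d.+1 -> V) :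
  \sum_k F (jmw v k) ((liftp b)^-1%g k) = \sum_k F (jmw v k) k.
Proof.
rewrite (reindex_inj (@perm_inj _ (liftp b))) /=; apply: eq_bigr => k _; rewrite permK /jmw.
by rewrite -{1}(lift_perm_id ord_max ord_max b) (inj_eq perm_inj).
Qed.

(** Conjugation by [liftp b] permutes the tau and fixes the identity: the Jucys-Murphy element of
    the last point commutes with S_d. *)
Lemma TT_liftp vs c p b s : TT vs c (p * liftp b)%g s = TT vs c p (b * s)%g.
Proof.
elim: vs c p => /= [|v vs IHvs] c p; first by rewrite liftpM mulgA.
rewrite -[RHS](sum_jm b v (fun u k => TT vs (u * c) (p * tau k)%g (b * s)%g)).
by apply: eq_bigr => k _; rewrite -IHvs -!mulgA liftp_tau.
Qed.

(** The prefix [p] is there for the induction: each tau already met stays to the left of all later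
    factors. *)
Lemma nest_decomp vs c p s :
  nest vs Psi c (p * liftp s)%g = nest vs (fun c' s' => TT vs c' p s') c s.
Proof.
elim: vs c p s => //= v vs IHvs c p s.
rewrite (reindex (@decomp d)) /=; last exact/onW_bij/decomp_bij.
rewrite -(pair_bigA _ (fun b k => nest vs Psi (v ^+ ncycles (decomp (b, k)) * c)
  (p * liftp s * decomp (b, k))%g)) /=.
apply: eq_bigr => b _.
rewrite -(nest_sum vs (index_enum _) (fun k c' s' => TT vs (jmw v k * c') (p * tau k)%g s')).
rewrite -(sum_jm s v (fun u k => nest vs (fun c' s' => TT vs (u * c') (p * tau k)%g s') _ (s * b)%g)).
apply: eq_bigr => k _.
rewrite -(nest_coef vs (fun c' s' => TT vs c' (p * tau ((liftp s)^-1%g k))%g s') (jmw v k)).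
rewrite -(IHvs _ (p * tau _)%g) /decomp /= ncycles_tperm_liftp.
congr (nest _ _ _ _).
  rewrite mulrA; congr (_ * _); rewrite exprD mulrC /jmw; congr (_ * _).
  by case: eqP; rewrite ?expr1 ?expr0.
by rewrite liftpM !mulgA -[(p * liftp s * tau k)%g]mulgA liftp_tau !mulgA.
Qed.

Lemma cutjoin_TT vs c p s : cutjoin (TT vs c p s) =
  2^-1 *: \sum_x \sum_(y | y != x) TT vs c (tperm x y * p)%g s.
Proof.
elim: vs c p => /= [|v vs IHvs] c p.
  rewrite cutjoin_cycles; congr (_ *: _).
  by apply: eq_bigr => x _; apply: eq_bigr => y _; rewrite mulgA.
rewrite linear_sum /=.
under eq_bigr => k _ do rewrite IHvs.
rewrite -scaler_sumr exchange_big /=; congr (_ *: _); apply: eq_bigr => x _.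
rewrite exchange_big; apply: eq_bigr => y _; apply: eq_bigr => k _.
by rewrite mulgA.
Qed.

Lemma sum_ord_max (F : 'I_d.+1 -> V) :
  \sum_k F k = \sum_i F (lift ord_max i) + F ord_max.
Proof.
rewrite big_ord_recr /=; congr (_ + _); apply: eq_bigr => i _; congr F.
by apply: val_inj; rewrite /= /bump leqNgt ltn_ord.
Qed.

Lemma liftp_tperm (i j : 'I_d) :
  liftp (tperm i j) = tperm (lift ord_max i) (lift ord_max j).
Proof.
apply/permP => z; case: (unliftP ord_max z) => [k|] ->.
  rewrite /liftp lift_perm_lift.
  by case: tpermP => [->|->|/eqP ki /eqP kj]; rewrite ?tpermL ?tpermR // tpermD //;
     rewrite (inj_eq lift_inj) eq_sym.
by rewrite /liftp lift_perm_id tpermD // eq_sym neq_lift.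
Qed.

(* The Jucys-Murphy element is the sum of all transpositions of d + 1 points
   minus that of d points: this produces the commutators with cutjoin. *)
Lemma sum_tau vs c s :
  \sum_(i < d) TT vs c (tau (lift ord_max i)) s =
  cutjoin (TT vs c 1%g s)
    - 2^-1 *: \sum_(i < d) \sum_(j < d | j != i) TT vs c 1%g (tperm i j * s)%g.
Proof.
rewrite cutjoin_TT -scalerBr sum_ord_max.
have -> : \sum_(i < d) \sum_(y | y != lift ord_max i) TT vs c (tperm (lift ord_max i) y * 1)%g s
  = \sum_(i < d) \sum_(j < d | j != i) TT vs c 1%g (tperm i j * s)%g
    + \sum_(i < d) TT vs c (tau (lift ord_max i)) s.
  rewrite -big_split /=; apply: eq_bigr => i _.
  rewrite big_mkcond sum_ord_max neq_lift mulg1; congr (_ + _).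
  rewrite [RHS]big_mkcond; apply: eq_bigr => j _; rewrite (inj_eq lift_inj) mulg1.
  by case: eqP => //= _; rewrite -TT_liftp mul1g liftp_tperm.
have -> : \sum_(y | y != ord_max) TT vs c (tperm ord_max y * 1)%g s
    = \sum_(i < d) TT vs c (tau (lift ord_max i)) s.
  rewrite big_mkcond sum_ord_max eqxx addr0; apply: eq_bigr => i _.
  by rewrite eq_sym neq_lift mulg1 tpermC.
(* Pairs containing the last point occur twice, with it as x or as y, which absorbs the factor
   1/2. *)
rewrite -addrA addrC -addrA addrC addKr -mulr2n -scaler_nat scalerA.
by rewrite mulVf ?scale1r // pnatr_eq0.
Qed.

Definition vpoly vs : {poly A} := \prod_(v <- vs) ('X + v%:P).

Lemma size_vpoly vs : (size (vpoly vs) <= (size vs).+1)%N.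
Proof.
have -> : vpoly vs = \prod_(v <- vs) ('X - (- v)%:P).
  by apply: eq_bigr => v _; rewrite polyCN opprK.
by rewrite size_prod_XsubC.
Qed.

(** Induction on the variables: the transpositions of the first factor act as ad(D) by [sum_tau],
    and the identity contributes v. In the base case, p_1 is the fixed last point of [liftp s]. *)
Lemma TT1 vs c s : TT vs c 1%g s
  = \sum_(0 <= k < (size vs).+1) adt k (psum ((vpoly vs)`_k * c) (cycle_sizes s)).
Proof.
elim: vs c s => [|v vs IHvs] c s.
  rewrite big_nat1 /vpoly big_nil coef1 mul1r /= mul1g.
  by rewrite (psum_perm _ (cycle_sizes_liftp s)).
rewrite /= sum_ord_max /jmw eqxx tperm1 mul1g IHvs.
have aZ k u (g : V) : adt k (u *: g) = u *: adt k g by exact: linearZ.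
have a0 k : adt k 0 = 0 :> V by exact: linear0.
have aD k (g h : V) : adt k (g + h) = adt k g + adt k h by exact: linearD.
have aS k (I : Type) (r : seq I) (P : pred I) (F : I -> V) :
  adt k (\sum_(i <- r | P i) F i) = \sum_(i <- r | P i) adt k (F i) by exact: linear_sum.
have cS (F : nat -> V) : cutjoin (\sum_(0 <= k < (size vs).+1) F k)
  = \sum_(0 <= k < (size vs).+1) cutjoin (F k) by exact: linear_sum.
have p0 : psum (0 : A) (cycle_sizes s) = 0 by rewrite -(scale0r (0 : A)) psumZ scale0r.
rewrite [X in X + _](_ : _ = \sum_(i < d) TT vs c (tau (lift ord_max i)) s); last first.
  by apply: eq_bigr => i _; rewrite eq_sym (negPf (neq_lift _ _)) mul1r mul1g.
rewrite sum_tau IHvs cS [X in _ - X + _](_ : _ = \sum_(0 <= k < (size vs).+1)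
  adt k (cutjoin (psum ((vpoly vs)`_k * c) (cycle_sizes s)))); last first.
  transitivity (2^-1 *: \sum_(i < d) \sum_(j < d | j != i) \sum_(0 <= k < (size vs).+1)
     adt k (psum ((vpoly vs)`_k * c) (cycle_sizes (tperm i j * s)%g))).
    by congr (_ *: _); apply: eq_bigr => i _; apply: eq_bigr => j _; exact: IHvs.
  rewrite [RHS](eq_bigr (fun k => 2^-1 *: \sum_(i < d) \sum_(j < d | j != i)
     adt k (psum ((vpoly vs)`_k * c) (cycle_sizes (tperm i j * s)%g)))) => [|k _].
    rewrite -scaler_sumr exchange_big; congr (_ *: _); apply: eq_bigr => i _.
    by rewrite exchange_big.
  by rewrite cutjoin_cycles aZ aS; congr (_ *: _); apply: eq_bigr => i _; rewrite aS.
rewrite -sumrB.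
have e k : (vpoly (v :: vs))`_k = (if k is k'.+1 then (vpoly vs)`_k' else 0) + v * (vpoly vs)`_k.
  by rewrite /vpoly big_cons mulrDl coefD coefXM coefCM; case: k.
under [RHS]eq_bigr => k _ do rewrite e mulrDl psumD aD.
rewrite [RHS]big_split /=; congr (_ + _).
  by rewrite [RHS]big_nat_recl // mul0r p0 a0 add0r.
rewrite [RHS]big_nat_recr // nth_default ?size_vpoly // mulr0 mul0r p0 a0 /= addr0.
by apply: eq_bigr => k _; rewrite mulrA [v * _]mulrC.
Qed.
End Nest.

(** * The main recursion *)

Section FallingBasis.
Variable R : nzRingType.
Implicit Types (p : {poly R}) (c : nat -> R).

Lemma coef_falling n : (falling R n)`_n = 1.
Proof.
have /monicP := monic_prod_XsubC (index_enum 'I_n) predT (fun j : 'I_n => j%:R : R).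
by rewrite lead_coefE -/(falling R n) size_falling.
Qed.

Lemma falling_span n p : (size p <= n)%N ->
  exists c, p = \sum_(i < n) (c i)%:P * falling R i.
Proof.
elim: n p => [|n IHn] p sp.
  by exists (fun=> 0); rewrite big_ord0; apply/eqP; rewrite -size_poly_leq0.
have [|c e] := IHn (p - (p`_n)%:P * falling R n).
  apply/leq_sizeP => j; rewrite leq_eqVlt coefB coefCM => /predU1P[<-|nj].
    by rewrite coef_falling mulr1 subrr.
  by rewrite (nth_default _ (leq_trans sp nj)) [X in _ * X]nth_default ?size_falling // mulr0 subr0.
exists (fun i => if i == n then p`_n else c i).
rewrite big_ord_recr /= eqxx -[LHS](subrK ((p`_n)%:P * falling R n)) e; congr (_ + _).
by apply: eq_bigr => i _; rewrite ltn_eqF.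
Qed.

Lemma falling_free n c : \sum_(i < n) (c i)%:P * falling R i = 0 ->
  forall i, (i < n)%N -> c i = 0.
Proof.
elim: n => // n IHn; rewrite big_ord_recr /= => e.
have c0 : c n = 0.
  have := congr1 (fun p : {poly R} => p`_n) e.
  rewrite coefD coef_sum coefCM coef_falling mulr1 coef0 big1 ?add0r // => i _.
  by rewrite coefCM nth_default ?mulr0 // size_falling.
move=> i; rewrite ltnS leq_eqVlt => /predU1P[-> //|]; apply: IHn.
by move: e; rewrite c0 mul0r addr0.
Qed.
End FallingBasis.

(** Falling factorials form a basis, and the factors i + 1 are invertible in an algebra over the
    rationals. *)
Lemma falling_coords (A : comAlgType rat) n (p : {poly A}) : (size p <= n)%N ->
  exists! a : {ffun 'I_n -> A}, \sum_(i < n) (i.+1%:R * a i)%:P * falling A i = p.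
Proof.
case/falling_span => c ->.
have nK (i : nat) (x : A) : (i.+1%:R)^-1 *: (i.+1%:R * x) = x.
  by rewrite mulr_natl -scaler_nat scalerA mulVf ?scale1r // pnatr_eq0.
have nVK (i : nat) (x : A) : i.+1%:R * ((i.+1%:R)^-1 *: x) = x.
  by rewrite -scalerAr nK.
exists [ffun i : 'I_n => (i.+1%:R)^-1 *: c i]; split.
  by apply: eq_bigr => i _; rewrite ffunE nVK.
move=> b eb; apply/ffunP => i; rewrite ffunE; case: n c b eb i => [|n] c b eb i; first by case: i.
have := @falling_free A n.+1 (fun j => c j - j.+1%:R * b (inord j)).
have -> : \sum_(j < n.+1) (c j - j.+1%:R * b (inord j))%:P * falling A j = 0.
  by under eq_bigr => j _ do rewrite polyCB mulrBl inord_val; rewrite sumrB -eb subrr.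
by move/(_ erefl i (ltn_ord i))/eqP; rewrite inord_val subr_eq0 => /eqP->.
Qed.

(** * Linearity over the coefficient algebra and the identity of the a_k *)

Section Coefficients.
Variable A : comAlgType rat.
Implicit Types (f : series A) (u c : A).
Local Notation V := (series A).

(** The operators were built over rational modules, so their linearity over [A] is stated through
    this product. *)
Definition smul u f : V := fun mu => u * f mu.

Lemma current_smul l u f : current l (smul u f) = smul u (current l f).
Proof.
apply/funext => mu; rewrite /smul; case: (currentP l) => [p|p|].
- by rewrite !current_Posz /diff_t mulrnAr.
- rewrite !current_Negz !seriesZ /mul_t.
  by case: ifP => _; rewrite ?scaler0 ?mulr0 // scalerAr.
- by rewrite !current0; exact/esym/mulr0.
Qed.

Lemma nord_smul (X : fam A) u : (forall m f, X m (smul u f) = smul u (X m f)) ->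
  forall m f, nord X m (smul u f) = smul u (nord X m f).
Proof.
move=> Xu m f; apply/funext => mu; rewrite /smul /nord /nord_upto !series_sum mulr_sumr.
apply: eq_bigr => n _; rewrite !seriesD mulrDr; congr (_ + _).
  by rewrite -/(smul u f) Xu current_smul.
by rewrite -/(smul u f) current_smul Xu.
Qed.

Lemma cutjoin_smul u f : cutjoin (smul u f) = smul u (cutjoin f).
Proof.
have f1 m g : fone m (smul u g) = smul u (fone m g).
  rewrite /fone; case: eqP => // _; apply/funext => mu; exact/esym/mulr0.
have J3 : forall m g, Jpow 3 m (smul u g) = smul u (Jpow 3 m g).
  by do 3!apply: nord_smul.
by apply/funext => mu; rewrite /cutjoin J3 /smul !seriesZ scalerAr.
Qed.

Lemma adt_smul k u f : adt k (smul u f) = smul u (adt k f).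
Proof.
elim: k f => [|k IHk] f /=; first exact: current_smul.
by rewrite cutjoin_smul !IHk cutjoin_smul; apply/funext => mu; rewrite /smul !seriesE mulrBr.
Qed.

Lemma psum_smul u c s : psum (u * c) s = smul u (psum c s).
Proof.
elim: s => [|n s IHs] /=; last by rewrite IHs current_smul.
by apply/funext => mu; rewrite /smul /vac; case: eqP; rewrite ?mulr0.
Qed.

Lemma psum_sum (I : Type) (r : seq I) (F : I -> A) s :
  psum (\sum_(i <- r) F i) s = \sum_(i <- r) psum (F i) s.
Proof.
apply: (big_morph (fun a => psum a s)) => [x y|]; first exact: psumD.
by rewrite -(scale0r (0 : A)) psumZ scale0r.
Qed.

Lemma map_falling i : falling A i = map_poly (in_alg A) (falling rat i).
Proof.
rewrite rmorph_prod; apply: eq_bigr => j _.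
by rewrite rmorphB /= map_polyX map_polyC /= scaler_nat.
Qed.

(** [adt_falling] padded with zero coefficients to the common length [n], so that the sums over i
    and k can be exchanged. *)
Lemma smul_Pop n i u c s : (i < n)%N ->
  smul u (Pop i.+1 (-1) (psum c s))
  = \sum_(0 <= k < n) adt k (psum (i.+1%:R * u * (falling A i)`_k * c) s).
Proof.
move=> lt_in.
have -> : Pop i.+1 (-1) (psum c s)
    = \sum_(0 <= k < n) (i.+1%:R * (falling rat i)`_k) *: adt k (psum c s).
  rewrite Pop_Qfam // factS natrM -scalerA -adt_falling; last exact: polyn_psum.
  rewrite [RHS](big_cat_nat (n := i.+1)) // [X in _ = _ + X]big_nat.
  rewrite [X in _ = _ + X]big1 => [|k /andP[ik _]].
    by rewrite addr0 scaler_sumr; apply: eq_bigr => k _; rewrite scalerA.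
  by rewrite nth_default ?size_falling // mulr0 scale0r.
apply/funext => mu; rewrite /smul !series_sum mulr_sumr; apply: eq_bigr => k _.
rewrite seriesZ -scalerAr map_falling coef_map /=.
have -> : i.+1%:R * u * ((falling rat i)`_k)%:A = (i.+1%:R * (falling rat i)`_k) *: u.
  by rewrite -scalerAr mulr1 mulr_natl -scaler_nat scalerA mulrC.
by rewrite psum_smul adt_smul /smul scalerAl.
Qed.

(** The identity defining the a_k, with ad(D) substituted for x. *)
Lemma sum_smul_Pop n (a : 'I_n -> A) (p : {poly A}) c s :
  \sum_(i < n) (i.+1%:R * a i)%:P * falling A i = p ->
  \sum_(i < n) smul (a i) (Pop i.+1 (-1) (psum c s))
  = \sum_(0 <= k < n) adt k (psum (p`_k * c) s).
Proof.
move=> <-; rewrite (eq_bigr _ (fun i _ => smul_Pop (a i) c s (ltn_ord i))).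
rewrite exchange_big; apply: eq_bigr => k _.
have aS (F : 'I_n -> V) : adt k (\sum_i F i) = \sum_i adt k (F i) by exact: linear_sum.
rewrite -aS -psum_sum -mulr_suml coef_sum.
by congr (adt k (psum (_ * c) s)); apply: eq_bigr => i _; rewrite coefCM.
Qed.

Definition Pcomb n (a : 'I_n -> A) f : V := \sum_(i < n) smul (a i) (Pop i.+1 (-1) f).

Lemma Pcomb_sum n (a : 'I_n -> A) (I : Type) (l : seq I) (F : I -> V) :
  Pcomb a (\sum_(x <- l) F x) = \sum_(x <- l) Pcomb a (F x).
Proof.
rewrite /Pcomb exchange_big; apply: eq_bigr => i _; apply/funext => mu.
rewrite Pop_Qfam // (graded_sum _ _ _ (@graded_Qfam A _)) /smul seriesZ !series_sum.
rewrite scaler_sumr mulr_sumr; apply: eq_bigr => x _.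
by rewrite Pop_Qfam.
Qed.

Lemma Pcomb_nest n (a : 'I_n -> A) d vs (F : A -> 'S_d -> V) c s :
  Pcomb a (nest vs F c s) = nest vs (fun c' s' => Pcomb a (F c' s')) c s.
Proof.
elim: vs c s => //= v vs IHvs c s; rewrite Pcomb_sum.
by apply: eq_bigr => b _; exact: IHvs.
Qed.

Lemma nest_cyclesS vs n (a : 'I_n -> A) d : n = (size vs).+1 ->
  \sum_(i < n) (i.+1%:R * a i)%:P * falling A i = vpoly vs ->
  nest vs (fun c (s : 'S_d.+1) => psum c (cycle_sizes s)) 1 1%g
  = Pcomb a (nest vs (fun c (s : 'S_d) => psum c (cycle_sizes s)) 1 1%g).
Proof.
move=> en aP; rewrite Pcomb_nest.
have -> : 1%g = (1 * liftp 1)%g :> 'S_d.+1 by rewrite mul1g /liftp lift_perm1.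
rewrite nest_decomp; apply: eq_nest => c s.
by rewrite TT1 -en /Pcomb (sum_smul_Pop _ _ aP).
Qed.

Lemma nest_ffun d (F : A -> 'S_d -> V) n (v : 'I_n -> A) c s :
  nest [seq v i | i <- enum 'I_n] F c s
  = \sum_(x : {ffun 'I_n -> 'S_d})
      F (\prod_i v i ^+ ncycles (x i) * c) (s * \prod_i x i)%g.
Proof.
elim: n v c s => [|n IHn] v c s.
  have -> : enum 'I_0 = [::] by apply: size0nil; rewrite size_enum_ord.
  rewrite (big_pred1 [ffun=> 1%g]) => [|x]; last by apply/esym/eqP/ffunP => -[].
  by rewrite !big_ord0 mul1r mulg1.
rewrite enum_ordSl /= -map_comp.
(* A tuple is its first entry, matching the head of the list of variables, together with the
   rest. *)
pose h (y : 'S_d * {ffun 'I_n -> 'S_d}) : {ffun 'I_n.+1 -> 'S_d} :=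
  [ffun i => if unlift ord0 i is Some j then y.2 j else y.1].
have h_bij : bijective h.
  exists (fun x : {ffun 'I_n.+1 -> 'S_d} => (x ord0, [ffun j => x (lift ord0 j)])) => [[b x]|x].
    rewrite /h ffunE unlift_none /=; congr (_, _).
    by apply/ffunP => j; rewrite !ffunE liftK.
  by apply/ffunP => i; rewrite ffunE; case: unliftP => [j|] ->; rewrite ?ffunE.
rewrite [RHS](reindex h) /=; last exact: onW_bij.
rewrite -(pair_bigA _ (fun b x => F (\prod_i v i ^+ ncycles (h (b, x) i) * c)
   (s * \prod_i h (b, x) i)%g)) /=.
apply: eq_bigr => b _; rewrite (IHn (fun i => v (lift ord0 i))); apply: eq_bigr => x _.
congr F; rewrite [in RHS]big_ord_recl ffunE unlift_none /=.
  rewrite -mulrA mulrCA; congr (_ * (_ * _)); apply: eq_bigr => i _.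
  by rewrite ffunE liftK.
rewrite mulgA; congr (_ * _)%g; apply: eq_bigr => i _.
by rewrite ffunE liftK.
Qed.
End Coefficients.

Section DessinRecursion.
Variable r : nat.
Local Notation A := {mpoly rat[r]}.
Implicit Types (a : {ffun 'I_r.+1 -> A}).

Definition vlist : seq A := [seq 'X_i | i <- enum 'I_r].

Lemma vpoly_vlist : vpoly vlist = \prod_(i < r) ('X + ('X_i)%:P).
Proof. by rewrite /vpoly big_map big_enum. Qed.

Lemma size_vlist : size vlist = r.
Proof. by rewrite size_map size_enum_ord. Qed.

Lemma a_identity_unique : exists! a, a_identity a.
Proof.
have [|a [aP aU]] := @falling_coords A r.+1 (vpoly vlist).
  by rewrite (leq_trans (size_vpoly _)) // size_vlist.
rewrite vpoly_vlist in aP aU.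
by exists a; split=> [|b bP]; [exact: aP | exact: aU].
Qed.

Lemma dessin_op_Pcomb a f : dessin_op a f = Pcomb a f.
Proof. by apply/funext => mu; rewrite /Pcomb series_sum. Qed.

Lemma dessin_sum_nest d :
  dessin_sum r d = nest vlist (fun c (s : 'S_d) => psum c (cycle_sizes s)) 1 1%g.
Proof. by rewrite nest_ffun; apply: eq_bigr => x _; rewrite mulr1 mul1g. Qed.

Lemma dessin_sumS a d : a_identity a ->
  dessin_sum r d.+1 = dessin_op a (dessin_sum r d).
Proof.
rewrite /a_identity -vpoly_vlist => aP; rewrite dessin_op_Pcomb !dessin_sum_nest.
by apply: nest_cyclesS aP; rewrite size_vlist.
Qed.

Lemma dessin_sum0 : dessin_sum r 0 = series1 A.
Proof.
have n0 (s : 'S_0) : #|porbits s| = 0%N.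
  by apply/eqP; rewrite -leqn0 (leq_trans (leq_imset_card _ _)) // card_ord.
rewrite /dessin_sum (big_pred1 [ffun=> 1%g]) => [|x]; last first.
  by apply/esym/eqP/ffunP => i; apply/permP => -[].
have -> s : cycle_sizes (s : 'S_0) = [::] by apply: size0nil; rewrite size_map -cardE.
by rewrite /cmono big1 // => i _; rewrite /ncycles n0 expr0.
Qed.
End DessinRecursion.

Theorem theorem3p5 (r : nat) (r_gt0 : (0 < r)%N) :
  (exists! a : {ffun 'I_r.+1 -> {mpoly rat[r]}}, a_identity a) /\
  (forall a : {ffun 'I_r.+1 -> {mpoly rat[r]}}, a_identity a ->
     p_to_t (Zdessin r) = exp_s (dessin_op a) (series1 {mpoly rat[r]})).
Proof.
split=> [|a aP]; first exact: a_identity_unique.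
have iterE d : iter d (dessin_op a) (series1 {mpoly rat[r]}) = dessin_sum r d.
  by elim: d => [|d IHd]; rewrite ?dessin_sum0 // (dessin_sumS _ aP) -IHd.
apply/funext => d; apply/funext => mu.
by rewrite p_to_t_Zdessin /exp_s iterE.
Qed.
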